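(* Let $d\geq 1$ and let $\nu$ be a Reinhardt measure on $\partial\mathbb B$. If $K_1$ and $K_2$ are any two members of the class $\mathcal K_\nu$, then the multiplication tuple $M_z=(M_{z_1},\dots,M_{z_d})$ on $\mathcal H(K_1+K_2)$ is a subnormal spherical contraction.
   Context: $\mathbb B$ is the open unit ball of $\mathbb C^d$ and $\partial\mathbb B$ the unit sphere. A Reinhardt measure is a finite positive Borel measure supported in $\partial\mathbb B$ that is invariant under the action of the torus $\mathbb T^d=\{z\in\mathbb C^d:|z_1|=\dots=|z_d|=1\}$. For $\alpha\in\mathbb Z_+^d$, $|\alpha|=\alpha_1+\dots+\alpha_d$. Spherically balanced spaces: for positive numbers $\{\beta_\alpha\}_{\alpha\in\mathbb Z_+^d}$, $H^2(\beta)$ is the Hilbert space of formal power series $f(z)=\sum_\alpha\hat f(\alpha)z^\alpha$ with $\|f\|^2_{H^2(\beta)}=\sum_\alpha|\hat f(\alpha)|^2\beta_\alpha^2<\infty$; similarly, for positive $\gamma=\{\gamma_k\}_{k\geq0}$, $H^2(\gamma)$ is the one-variable space with norm $\left(\sum_k|\hat g(k)|^2\gamma_k^2\right)^{1/2}$. $H^2(\beta)$ is spherically balanced, with slice representation $[\nu,H^2(\gamma)]$, if there are a Reinhardt measure $\nu$ and such a space $H^2(\gamma)$ with $\|f\|^2_{H^2(\beta)}=\int_{\partial\mathbb B}\|f_z\|^2_{H^2(\gamma)}\,d\nu(z)$ for all $f\in H^2(\beta)$, where $f_z(\zeta)=f(\zeta z)$ is the slice of $f$ (a power series in one variable $\zeta$),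 and $\beta_\alpha=\gamma_{|\alpha|}\|z^\alpha\|_{L^2(\partial\mathbb B,\nu)}$ for all $\alpha$. A kernel $K(z,w)=\sum_\alpha a_\alpha z^\alpha\bar w^\alpha$ ($z,w\in\mathbb B$, $a_\alpha>0$) is a balanced kernel if its reproducing kernel Hilbert space $\mathcal H(K)$ (which is $H^2(\beta)$ with $\beta_\alpha^2=1/a_\alpha$) is spherically balanced. $M_{z_i}$ is multiplication by the coordinate function $z_i$. For a tuple $T=(T_1,\dots,T_d)$ of bounded operators on $\mathcal H$ put $Q_T(X)=\sum_{i=1}^dT_i^*XT_i$, $Q_T^0(X)=X$, $Q_T^k(X)=Q_T(Q_T^{k-1}(X))$. A commuting tuple $T$ is a spherical contraction if $Q_T(I)\leq I$; jointly left invertible if $Q_T(I)\geq cI$ for some $c>0$; in that case its spherical Cauchy dual is $T^{\mathfrak s}=(T_1^{\mathfrak s},\dots,T_d^{\mathfrak s})$, $T_i^{\mathfrak s}=T_i(Q_T(I))^{-1}$. $T$ is a joint complete hyperexpansion if $\sum_{k=0}^n(-1)^k\binom nkQ_T^k(I)\leq0$ for all $n\geq1$. A commuting tuple $T$ of bounded operators is subnormal if there are a Hilbert space $\mathcal K\supset\mathcal H$ and a commuting tuple $N=(N_1,\dots,N_d)$ of bounded normal operators on $\mathcal K$ with $N_i\mathcal H\subset\mathcal H$ and $N_i|_{\mathcal H}=T_i$ for all $i$. The class $\mathcal K_\nu$ consists of all balanced kernels $K$ such that (i) the norm on $\mathcal H(K)$ admits a slice representation $[\nu,H^2(\gamma)]$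 with the fixed Reinhardt measure $\nu$; (ii) the multiplication tuple $M_z$ on $\mathcal H(K)$ (a tuple of bounded operators) is jointly left invertible; (iii) the spherical Cauchy dual tuple $M_z^{\mathfrak s}$ of $M_z$ is a joint complete hyperexpansion. *)

(* Defs.v *)
From HB Require Import structures.
From mathcomp Require Import all_boot all_order all_algebra finmap.
From mathcomp Require Import all_classical all_reals all_analysis.
From mathcomp Require Import complex ring lra.

Set Implicit Arguments.
Unset Strict Implicit.
Unset Printing Implicit Defensive.

Import Order.TTheory GRing.Theory Num.Theory Num.Def.
Import ComplexField.Normc.
Import numFieldNormedType.Exports.

Local Open Scope classical_set_scope.
Local Open Scope ring_scope.

Local Notation Re := complex.Re.
Local Notation Im := complex.Im.

Section sums.
Variables (R : realType) (I : choiceType).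
Implicit Types (f g p q : I -> R) (u v : I -> R[i]).

(* Unordered sums of absolutely summable families; rsum and csum are junk on
   families that are not rsummable, resp. csummable. *)
Definition rsum f : R :=
  fine (esum setT (EFin \o f)^\+%E) - fine (esum setT (EFin \o f)^\-%E).

Definition csum u : R[i] :=
  Complex (rsum (fun i => Re (u i))) (rsum (fun i => Im (u i))).

Definition rsummable f := summable setT (EFin \o f).
Definition csummable u := rsummable (fun i => normc (u i)).

Lemma esumZ (a : R) p : 0 <= a -> (forall i, 0 <= p i) ->
  (\esum_(i in [set: I]) (a * p i)%:E = a%:E * \esum_(i in [set: I]) (p i)%:E)%E.
Proof.
have le (b : R) (r : I -> R) : 0 <= b -> (forall i, 0 <= r i) ->
  (\esum_(i in [set: I]) (b * r i)%:E <= b%:E * \esum_(i in [set: I]) (r i)%:E)%E.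
  move=> b0 r0; apply: ge_ereal_sup => _ [A [finA AT] <-].
  rewrite fsbig_finite//= (eq_bigr (fun i => b%:E * (r i)%:E)%E)//.
  rewrite -ge0_sume_distrr; last by move=> *; rewrite lee_fin.
  rewrite -fsbig_finite//; apply: lee_wpmul2l; first by rewrite lee_fin.
  by apply: esum_ge; exists A.
rewrite le_eqVlt => /predU1P[<- p0|a0 p0].
  by rewrite mul0e esum1// => i _; rewrite mul0r.
apply/eqP; rewrite eq_le le ?(ltW a0)//=.
rewrite -lee_pdivlMl//; apply: le_trans (le _ _ _ _).
- by apply: le_esum => i _; rewrite mulKf ?gt_eqF.
- by rewrite invr_ge0 ltW.
- by move=> i; rewrite mulr_ge0// ltW.
Qed.

Lemma rsummable_le f g : (forall i, `|f i| <= `|g i|) ->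
  rsummable g -> rsummable f.
Proof.
move=> fg; apply: le_lt_trans; apply: le_esum => i _ /=.
by rewrite lee_fin.
Qed.

Lemma rsummableD f g : rsummable f -> rsummable g ->
  rsummable (fun i => f i + g i).
Proof. by move=> sf sg; exact: (summableD sf sg). Qed.

Lemma rsummableZ (a : R) f : rsummable f -> rsummable (fun i => a * f i).
Proof.
rewrite /rsummable /summable /=.
rewrite (eq_esum (a := fun i => `|a * f i|%:E) (b := fun i => (`|a| * `|f i|)%:E)); last first.
  by move=> i _; rewrite -normrM.
by move=> sf; rewrite esumZ// lte_mul_pinfty// lee_fin.
Qed.

Lemma ge0_rsummableE p : (forall i, 0 <= p i) ->
  rsummable p = (\esum_(i in [set: I]) (p i)%:E < +oo)%E.
Proof.
move=> p0; rewrite /rsummable /summable; congr (_ < _)%E.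
by apply: eq_esum => i _ /=; rewrite ger0_norm.
Qed.

Lemma rsummable_fin p : (forall i, 0 <= p i) -> rsummable p ->
  (\esum_(i in [set: I]) (p i)%:E)%E \is a fin_num.
Proof.
move=> p0; rewrite /rsummable summableE; congr (_ \is a fin_num).
by apply: eq_esum => i _ /=; rewrite ger0_norm.
Qed.

Lemma rsumE p q : (forall i, 0 <= p i) -> (forall i, 0 <= q i) ->
  rsummable p -> rsummable q ->
  rsum (fun i => p i - q i) = fine (\esum_(i in [set: I]) (p i)%:E)%E
    - fine (\esum_(i in [set: I]) (q i)%:E)%E.
Proof.
move=> p0 q0 sp sq; have fp := rsummable_fin p0 sp; have fq := rsummable_fin q0 sq.
have := esumB sp sq (fun i _ => p0 i) (fun i _ => q0 i) => /=.
have s : summable setT ((EFin \o p) \- (EFin \o q))%E by exact: summableB.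
have := summable_funepos s; have := summable_funeneg s.
rewrite !summableE.
rewrite (eq_esum (a := fun i => `|((((EFin \o p) \- (EFin \o q))^\-)%E i)|%E)
  (b := (((EFin \o p) \- (EFin \o q))^\-)%E)); last first.
  by move=> i _; rewrite gee0_abs.
rewrite (eq_esum (a := fun i => `|((((EFin \o p) \- (EFin \o q))^\+)%E i)|%E)
  (b := (((EFin \o p) \- (EFin \o q))^\+)%E)); last first.
  by move=> i _; rewrite gee0_abs.
move=> f1 f2 e; rewrite /rsum -!fineB// -?e//.
Qed.

Lemma rsum_posneg f : f = (fun i => maxr (f i) 0 - maxr (- f i) 0).
Proof.
apply/funext => i; case: (leP 0 (f i)) => h.
  by rewrite (max_idPr _) ?oppr_le0// subr0.
by rewrite (max_idPl _) ?oppr_ge0 1?ltW// sub0r opprK.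
Qed.

Lemma rsummable_pos f : rsummable f -> rsummable (fun i => maxr (f i) 0).
Proof.
apply: rsummable_le => i; case: (leP 0 (f i)) => // h.
by rewrite normr0.
Qed.

Lemma rsummableN f : rsummable f -> rsummable (fun i => - f i).
Proof. by apply: rsummable_le => i; rewrite normrN. Qed.

Let P f i : R := maxr (f i) 0.
Let N f i : R := maxr (- f i) 0.

Let P0 f i : 0 <= P f i. Proof. by rewrite le_max lexx orbT. Qed.
Let N0 f i : 0 <= N f i. Proof. by rewrite le_max lexx orbT. Qed.

Let PN f i : f i = P f i - N f i.
Proof. by have /(congr1 (fun h => h i)) := rsum_posneg f. Qed.

Let sP f : rsummable f -> rsummable (P f).
Proof. exact: rsummable_pos. Qed.
Let sN f : rsummable f -> rsummable (N f).
Proof. by move=> sf; apply: rsummable_pos; exact: rsummableN. Qed.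

Let rsumPN f : rsummable f ->
  rsum f = fine (\esum_(i in [set: I]) (P f i)%:E)%E
         - fine (\esum_(i in [set: I]) (N f i)%:E)%E.
Proof.
move=> sf; rewrite -rsumE//; [|exact: sP|exact: sN].
by congr rsum; apply/funext => i; exact: PN.
Qed.

Lemma rsumD f g : rsummable f -> rsummable g ->
  rsum (fun i => f i + g i) = rsum f + rsum g.
Proof.
move=> sf sg.
have [sfp sfn sgp sgn] := And4 (sP sf) (sN sf) (sP sg) (sN sg).
transitivity (rsum (fun i => (P f i + P g i) - (N f i + N g i))).
  by congr rsum; apply/funext => i; rewrite {1}(PN f i) {1}(PN g i); lra.
rewrite (rsumPN sf) (rsumPN sg).
rewrite rsumE; first last.
- exact: rsummableD.
- exact: rsummableD.
- by move=> i; rewrite addr_ge0.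
- by move=> i; rewrite addr_ge0.
rewrite (esumD (a := fun i => (P f i)%:E) (b := fun i => (P g i)%:E)); last 2 first.
- by move=> i _; rewrite lee_fin.
- by move=> i _; rewrite lee_fin.
rewrite (esumD (a := fun i => (N f i)%:E) (b := fun i => (N g i)%:E)); last 2 first.
- by move=> i _; rewrite lee_fin.
- by move=> i _; rewrite lee_fin.
rewrite !fineD ?rsummable_fin//; lra.
Qed.

Lemma rsumN f : rsummable f -> rsum (fun i => - f i) = - rsum f.
Proof.
move=> sf; rewrite (rsumPN sf) opprB.
rewrite -rsumE//; [|exact: sN|exact: sP].
by congr rsum; apply/funext => i; rewrite {1}(PN f i) opprB.
Qed.

Lemma rsum_ge0 p : (forall i, 0 <= p i) -> rsummable p ->
  rsum p = fine (\esum_(i in [set: I]) (p i)%:E)%E.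
Proof.
move=> p0 sp; have z0 (i : I) : 0 <= (fun=> 0 : R) i by [].
have sz : rsummable (fun=> 0) by rewrite /rsummable /summable esum1// => i _ /=; rewrite normr0.
have := rsumE p0 z0 sp sz.
rewrite (_ : (fun i => _) = p); last by apply/funext => i; rewrite subr0.
by move=> ->; rewrite (@esum1 _ _ _ (fun=> 0%:E))//= subr0.
Qed.

Lemma rsumZ a f : rsummable f -> rsum (fun i => a * f i) = a * rsum f.
Proof.
wlog a0 : a / 0 <= a => [hw|].
  case: (leP 0 a) => [/hw//|a0] sf.
  rewrite (_ : (fun i => _) = (fun i => - (- a * f i))); last first.
    by apply/funext => i; rewrite mulNr opprK.
  rewrite rsumN; last exact: rsummableZ.
  by rewrite hw// ?oppr_ge0 1?ltW// mulNr opprK.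
move=> sf; rewrite (rsumPN sf).
transitivity (rsum (fun i => a * P f i - a * N f i)).
  by congr rsum; apply/funext => i; rewrite {1}(PN f i) mulrBr.
rewrite rsumE; first last.
- by apply: rsummableZ; exact: sN.
- by apply: rsummableZ; exact: sP.
- by move=> i; rewrite mulr_ge0.
- by move=> i; rewrite mulr_ge0.
rewrite !esumZ// !fineM ?rsummable_fin ?mulrBr//; [exact: sN|exact: sP].
Qed.

Lemma normc_ge0 (z : R[i]) : 0 <= normc z.
Proof. by case: z => a b; exact: sqrtr_ge0. Qed.

Lemma normcE (z : R[i]) : (normc z)%:C%C = `|z|.
Proof. by []. Qed.

Lemma sqr_normc (z : R[i]) : normc z ^+ 2 = Re z ^+ 2 + Im z ^+ 2.
Proof. by case: z => a b /=; rewrite sqr_sqrtr// addr_ge0// sqr_ge0. Qed.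

Lemma le_Re_normc (z : R[i]) : `|Re z| <= normc z.
Proof.
rewrite -(@ler_pXn2r _ 2)// ?nnegrE// ?normc_ge0//.
by rewrite sqr_normc real_normK ?num_real// lerDl sqr_ge0.
Qed.

Lemma le_Im_normc (z : R[i]) : `|Im z| <= normc z.
Proof.
rewrite -(@ler_pXn2r _ 2)// ?nnegrE// ?normc_ge0//.
by rewrite sqr_normc real_normK ?num_real// lerDr sqr_ge0.
Qed.

Lemma le_normcD (x y : R[i]) : normc (x + y) <= normc x + normc y.
Proof. by rewrite -lecR rmorphD /= !normcE ler_normD. Qed.

Lemma csummable_Re u : csummable u -> rsummable (fun i => Re (u i)).
Proof.
by apply: rsummable_le => i; rewrite (ger0_norm (normc_ge0 _)) le_Re_normc.
Qed.

Lemma csummable_Im u : csummable u -> rsummable (fun i => Im (u i)).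
Proof.
by apply: rsummable_le => i; rewrite (ger0_norm (normc_ge0 _)) le_Im_normc.
Qed.

Lemma csummableD u v : csummable u -> csummable v ->
  csummable (fun i => u i + v i).
Proof.
move=> su sv; apply: rsummable_le (rsummableD su sv) => i.
by rewrite !ger0_norm ?addr_ge0 ?normc_ge0// le_normcD.
Qed.

Lemma csummableZ (a : R[i]) u : csummable u -> csummable (fun i => a * u i).
Proof.
move=> su; apply: rsummable_le (rsummableZ (normc a) su) => i.
by rewrite normcM.
Qed.

Lemma csumD u v : csummable u -> csummable v ->
  csum (fun i => u i + v i) = csum u + csum v.
Proof.
move=> su sv; rewrite /csum; apply/eqP; rewrite eq_complex /=.
rewrite -rsumD; [|exact: csummable_Re..].
rewrite -rsumD; [|exact: csummable_Im..].
by apply/andP; split; apply/eqP; congr rsum; apply/funext => i; case: (u i) (v i) => ? ? [].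
Qed.

Lemma csumZ (a : R[i]) u : csummable u ->
  csum (fun i => a * u i) = a * csum u.
Proof.
move=> su; have sr := csummable_Re su; have si := csummable_Im su.
case: a => a b; rewrite /csum; apply/eqP; rewrite eq_complex /=.
rewrite -!rsumZ//; apply/andP; split; apply/eqP.
  rewrite -rsumN; last exact: rsummableZ.
  rewrite -rsumD; [|exact: rsummableZ|by apply: rsummableN; exact: rsummableZ].
  by congr rsum; apply/funext => i; case: (u i).
rewrite -rsumD; [|exact: rsummableZ..].
by congr rsum; apply/funext => i; case: (u i).
Qed.

Lemma csum_conj u : csummable u -> csum (fun i => (u i)^*) = (csum u)^*.
Proof.
move=> su; have si := csummable_Im su.
rewrite /csum; apply/eqP; rewrite eq_complex /=; apply/andP; split; apply/eqP.
  by congr rsum; apply/funext => i; case: (u i).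
by rewrite -rsumN//; congr rsum; apply/funext => i; case: (u i).
Qed.

Lemma csum_real p : csum (fun i => (p i)%:C%C) = (rsum p)%:C%C.
Proof.
rewrite /csum /=; apply/eqP; rewrite eq_complex /= eqxx /=.
by rewrite /rsum !esum1 ?subrr//= => i _; rewrite ?funeposE ?funenegE /= ?oppr0 maxxx.
Qed.

End sums.

Definition form_norm (R : realType) (H : lmodType R[i])
  (form : {dot H for conjC}) (x : H) : R := Num.sqrt (Re (form x x)).

Definition form_complete (R : realType) (H : lmodType R[i])
    (form : {dot H for conjC}) :=
  forall u : nat -> H,
    (forall e : R, 0 < e -> exists N, forall m n, (N <= m)%N -> (N <= n)%N ->
      form_norm form (u m - u n) < e) ->
    exists l : H, forall e : R, 0 < e -> exists N, forall n, (N <= n)%N ->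
      form_norm form (u n - l) < e.

Record hilbertSpace (R : realType) := HilbertSpace {
  hilbert_sort :> lmodType R[i];
  hform : {dot hilbert_sort for conjC};
  hilbert_complete : form_complete hform }.

Definition hnorm (R : realType) (H : hilbertSpace R) (x : H) : R :=
  form_norm (hform H) x.

Section weighted_l2.
Variables (R : realType) (I : choiceType) (w : I -> {posnum R}).
Implicit Types f g : I -> R[i].

Definition sqnorm f : \bar R :=
  (\esum_(i in [set: I]) (normc (f i) ^+ 2 * (w i)%:num ^+ 2)%:E)%E.

Definition sqsummable : {pred I -> R[i]} := [pred f | `[< (sqnorm f < +oo)%E >]].

Lemma sqsummableP f :
  reflect (rsummable (fun i => normc (f i) ^+ 2 * (w i)%:num ^+ 2 : R))
          (f \in sqsummable).
Proof.
rewrite ge0_rsummableE; first exact: asboolP.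
by move=> i; rewrite !(sqr_ge0, mulr_ge0).
Qed.

Lemma sqsummable_submod : submod_closed sqsummable.
Proof.
split.
  apply/sqsummableP; apply: rsummable_le (rsummableZ 0 (_ : rsummable (fun i : I => 0))) => [i|].
    by rewrite normc0 expr0n/= !mul0r.
  by rewrite /rsummable /summable esum1// => i _ /=; rewrite normr0.
move=> a f g /sqsummableP sf /sqsummableP sg; apply/sqsummableP.
apply: rsummable_le (rsummableD (rsummableZ (2 * normc a ^+ 2) sf) (rsummableZ 2 sg)) => i.
rewrite [leRHS]ger0_norm; last first.
  by rewrite !(sqr_ge0, ler0n, addr_ge0, mulr_ge0).
rewrite ger0_norm; last by rewrite !(sqr_ge0, mulr_ge0).
rewrite [leRHS](_ : _ = (2 * (normc a * normc (f i)) ^+ 2 +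
  2 * normc (g i) ^+ 2) * (w i)%:num ^+ 2); last by ring.
apply: ler_wpM2r; first exact: sqr_ge0.
have h := le_normcD (a * f i) (g i).
have h0 := normc_ge0 (a * f i + g i).
apply: (@le_trans _ _ ((normc (a * f i) + normc (g i)) ^+ 2)).
  by apply: lerXn2r => //; rewrite nnegrE ?addr_ge0 ?normc_ge0.
rewrite normcM; set x := normc a * _; set y := normc (g i).
have := sqr_ge0 (x - y); rewrite sqrrB sqrrD; lra.
Qed.
HB.instance Definition _ := GRing.isSubmodClosed.Build R[i] _ sqsummable
  sqsummable_submod.

(* The weighted l^2 space of coefficient families: H^2(beta) for I = mindex d,
   and its squared norm on I = nat is that of the one-variable H^2(gamma). *)
Record H2 := MkH2 { coefs :> I -> R[i]; _ : coefs \in sqsummable }.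
HB.instance Definition _ := [isSub for coefs].
HB.instance Definition _ := [Choice of H2 by <:].
HB.instance Definition _ := [SubChoice_isSubLmodule of H2 by <:].

Definition H2form (f g : H2) : R[i] :=
  csum (fun i => f i * (g i)^* * ((w i)%:num ^+ 2)%:C%C).

Lemma coefs_summable (f : H2) : rsummable (fun i => normc (f i) ^+ 2 * (w i)%:num ^+ 2).
Proof. by apply/sqsummableP; case: f. Qed.

Lemma normc_conj (z : R[i]) : normc (z^*) = normc z.
Proof. by case: z => a b /=; rewrite sqrrN. Qed.

Lemma normc_real (x : R) : normc (x%:C%C) = `|x|.
Proof. by rewrite /= expr0n/= addr0 sqrtr_sqr. Qed.

Lemma H2form_summable (f g : H2) :
  csummable (fun i => f i * (g i)^* * ((w i)%:num ^+ 2)%:C%C).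
Proof.
apply: rsummable_le (rsummableD (coefs_summable f) (coefs_summable g)) => i.
rewrite !normcM normc_conj normc_real !ger0_norm ?sqr_ge0//; last 2 first.
- by rewrite !(sqr_ge0, ler0n, addr_ge0, mulr_ge0).
- by rewrite !(sqr_ge0, normc_ge0, mulr_ge0).
rewrite -mulrDl ler_wpM2r ?sqr_ge0//.
have := sqr_ge0 (normc (f i) - normc (g i)); rewrite sqrrB.
have := mulr_ge0 (normc_ge0 (f i)) (normc_ge0 (g i)); lra.
Qed.

Lemma H2formC (f g : H2) : H2form f g = (H2form g f)^*.
Proof.
rewrite /H2form -csum_conj; last exact: H2form_summable.
congr csum; apply/funext => i; rewrite !rmorphM /= conjCK.
rewrite [f i * _]mulrC; congr (_ * _).
by rewrite [in RHS]/conjC /= ?oppr0.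
Qed.

Lemma H2formPl (a : R[i]) (f g h : H2) :
  H2form (a *: f + g) h = a * H2form f h + H2form g h.
Proof.
have sf := H2form_summable f h; have sg := H2form_summable g h.
rewrite /H2form -csumZ// -csumD//; last exact: csummableZ.
congr csum; apply/funext => i.
by rewrite (_ : (a *: f + g) i = a * f i + g i)// !mulrDl !mulrA.
Qed.

Lemma H2form_bilinear : bilinear_for ( *%R : GRing.Scale.law _ _) (conjC \; *%R : GRing.Scale.law _ _) H2form.
Proof.
split => [h a f g|f a g h]; first exact: H2formPl.
rewrite H2formC H2formPl rmorphD rmorphM /=.
by rewrite -!(H2formC f).
Qed.

HB.instance Definition _ := bilinear_isBilinear.Build R[i] H2 H2 R[i] _ _ H2form
  H2form_bilinear.

Lemma H2form_hermitian (f g : H2) :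
  H2form f g = (-1) ^+ false * conjC (H2form g f).
Proof. by rewrite expr0 mul1r -H2formC. Qed.

HB.instance Definition _ := isHermitianSesquilinear.Build R[i] H2 false conjC H2form
  H2form_hermitian.

Lemma H2form_sqnorm (f : H2) : H2form f f = (fine (sqnorm f))%:C%C.
Proof.
rewrite /H2form /sqnorm -rsum_ge0.
- rewrite -csum_real; congr csum; apply/funext => i.
  by rewrite -normCK -normcE -rmorphXn -rmorphM.
- by move=> i; rewrite !(sqr_ge0, mulr_ge0).
- exact: coefs_summable.
Qed.

Lemma sqnorm_fin (f : H2) : sqnorm f \is a fin_num.
Proof.
apply: rsummable_fin (coefs_summable f) => i.
by rewrite !(sqr_ge0, mulr_ge0).
Qed.

Lemma le_coef_sqnorm (f : I -> R[i]) i :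
  ((normc (f i) ^+ 2 * (w i)%:num ^+ 2)%:E <= sqnorm f)%E.
Proof.
apply: esum_ge; exists [set i]; first by split => //; exact: finite_set1.
by rewrite fsbig_set1.
Qed.

Lemma H2form_gt0 (f : H2) : f != 0 -> 0 < H2form f f.
Proof.
move=> f0; rewrite H2form_sqnorm ltcR.
have [i fi0] : exists i, f i != 0.
  apply: contrapT => /forallNP h; move/eqP: f0; apply; apply/val_inj/funext => i /=.
  by apply/eqP/negPn/negP; exact: h.
rewrite -lte_fin fineK ?sqnorm_fin//; apply: lt_le_trans (le_coef_sqnorm f i).
rewrite lte_fin mulr_gt0// exprn_gt0//.
rewrite lt_neqAle normc_ge0 andbT eq_sym; apply: contra fi0 => /eqP.
by move=> /eq0_normc ->.
Qed.

HB.instance Definition _ := isDotProduct.Build R[i] H2 H2form H2form_gt0.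

Lemma form_norm_lt (f : H2) (e : R) : 0 < e ->
  (form_norm H2form f < e) = (sqnorm f < (e ^+ 2)%:E)%E.
Proof.
move=> e0; rewrite /form_norm [Re _](congr1 (@complex.Re R) (H2form_sqnorm f)) /=.
rewrite -[in LHS](ger0_norm (ltW e0)) -sqrtr_sqr ltr_sqrt ?exprn_gt0//.
by rewrite -lte_fin fineK// sqnorm_fin.
Qed.

Lemma real_cauchy_cvg (a : nat -> R) :
  (forall e : R, 0 < e -> exists N, forall m n, (N <= m)%N -> (N <= n)%N ->
    `|a m - a n| < e) -> exists l : R, a @ \oo --> l.
Proof.
move=> ca; apply/cvg_ex; apply: cauchy_cvg; apply: cauchy_exP => e e0.
have [N hN] := ca _ e0; exists (a N); exists N => // n /= Nn.
by rewrite /ball/=; apply: hN.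
Qed.

Lemma H2form_complete : form_complete H2form.
Proof.
move=> u cu.
have coefd (i : I) (e : R) : 0 < e -> exists N, forall m n, (N <= m)%N -> (N <= n)%N ->
    normc (u m i - u n i) < e.
  move=> e0; have ew0 : 0 < e * (w i)%:num by rewrite mulr_gt0.
  have [N hN] := cu _ ew0; exists N => m n Nm Nn.
  have := hN _ _ Nm Nn; rewrite form_norm_lt//.
  move=> /(le_lt_trans (le_coef_sqnorm (u m - u n) i)).
  rewrite lte_fin -exprMn => h.
  rewrite -(@ltr_pM2r _ (w i)%:num)//.
  have -> : u m i - u n i = (u m - u n) i by [].
  by move: h; rewrite ltr_pXn2r// ?nnegrE ?mulr_ge0 ?normc_ge0// ltW.
have /choice[lr hlr] : forall i, exists l : R, Re (u n i) @[n --> \oo] --> l.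
  move=> i; apply: real_cauchy_cvg => e e0.
  have [N hN] := coefd i e e0; exists N => m n Nm Nn.
  apply: le_lt_trans (hN _ _ Nm Nn).
  by rewrite (le_trans _ (le_Re_normc _))//; case: (u m i) (u n i) => ? ? [].
have /choice[li hli] : forall i, exists l : R, Im (u n i) @[n --> \oo] --> l.
  move=> i; apply: real_cauchy_cvg => e e0.
  have [N hN] := coefd i e e0; exists N => m n Nm Nn.
  apply: le_lt_trans (hN _ _ Nm Nn).
  by rewrite (le_trans _ (le_Im_normc _))//; case: (u m i) (u n i) => ? ? [].
pose l (i : I) : R[i] := Complex (lr i) (li i).
have key (e : R) : 0 < e -> exists N, forall n, (N <= n)%N ->
    (sqnorm (fun i => (u n i - l i)%R) <= (e ^+ 2)%:E)%E.
  move=> e0; have [N hN] := cu _ e0; exists N => n Nn.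
  apply: ge_ereal_sup => _ [A [finA _] <-]; rewrite fsbig_finite//= sumEFin lee_fin.
  have step m : (N <= m)%N ->
      \sum_(i <- fset_set A) normc (u n i - u m i) ^+ 2 * (w i)%:num ^+ 2 <= e ^+ 2.
    move=> Nm; rewrite -lee_fin -sumEFin -fsbig_finite//.
    have := hN _ _ Nn Nm; rewrite form_norm_lt// => /ltW; apply: le_trans.
    by apply: esum_ge; exists A.
  have cv : \sum_(i <- fset_set A) normc (u n i - u m i) ^+ 2 * (w i)%:num ^+ 2
      @[m --> \oo] --> \sum_(i <- fset_set A) normc (u n i - l i) ^+ 2 * (w i)%:num ^+ 2.
    elim: (fset_set A : seq I) => [|i s ih].
      rewrite big_nil (_ : (fun m => _) = fun=> 0); last first.
        by apply/funext => m; rewrite big_nil.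
      exact: cvg_cst.
    rewrite big_cons (_ : (fun m => _) = fun m =>
      normc (u n i - u m i) ^+ 2 * (w i)%:num ^+ 2 +
      \sum_(j <- s) normc (u n j - u m j) ^+ 2 * (w j)%:num ^+ 2); last first.
      by apply/funext => m; rewrite big_cons.
    apply: cvgD => //; apply: cvgMl.
    rewrite sqr_normc (_ : (fun m => _) = fun m =>
       (Re (u n i) - Re (u m i)) ^+ 2 + (Im (u n i) - Im (u m i)) ^+ 2); last first.
      by apply/funext => m; rewrite sqr_normc; case: (u n i) (u m i) => ? ? [].
    have -> : Re (u n i - l i) = Re (u n i) - lr i by case: (u n i).
    have -> : Im (u n i - l i) = Im (u n i) - li i by case: (u n i).
    apply: cvgD; rewrite expr2; under eq_fun do rewrite expr2;
      by apply: cvgM; apply: cvgB => //; exact: cvg_cst.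
  apply: (cvgr_to_le cv); exists N => // m /=; exact: step.
have lP : l \in sqsummable.
  have [N hN] := key 1 ltr01.
  have uN : (fun i => u N i - l i) \in sqsummable.
    by apply/asboolP; apply: le_lt_trans (hN _ (leqnn N)) _; rewrite ltry.
  have -> : l = (u N : I -> R[i]) - (fun i => u N i - l i).
    apply/funext => i; rewrite (_ : _ i = u N i - (u N i - l i))//.
    by rewrite opprB addrC subrK.
  by apply: rpredB => //; exact: valP.
exists (MkH2 lP) => e e0.
have e20 : 0 < e / 2 by rewrite divr_gt0.
have [N hN] := key _ e20; exists N => n Nn; rewrite form_norm_lt//.
apply: le_lt_trans (hN _ Nn) _.
rewrite lte_fin ltr_pXn2r ?nnegrE ?ltW// ltr_pdivrMr//.
by rewrite mulr_natr mulr2n ltrDl.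
Qed.

Definition H2space : hilbertSpace R := HilbertSpace H2form_complete.
End weighted_l2.

Section operators.
Variables (R : realType) (H : hilbertSpace R) (d : nat).
Implicit Types (X Y : H -> H) (T : 'I_d -> H -> H).

Definition bounded_op X :=
  linear X /\
  exists M : R, forall x, hnorm (X x) <= M * hnorm x.

(* For bounded X the adjoint exists (Riesz) and is unique, so the choice is
   immaterial; likewise for op_inv when X is invertible. *)
Definition adjoint X : H -> H :=
  xget (fun=> 0)
    [set Y | bounded_op Y /\ forall x y, hform H (X x) y = hform H x (Y y)].

Definition op_inv X : H -> H :=
  xget (fun=> 0) [set Y | [/\ bounded_op Y, cancel X Y & cancel Y X]].

(* The order on R[i] forces <(Y - X) x, x> to be real and nonnegative. *)
Definition op_le X Y := forall x, hform H (X x) x <= hform H (Y x) x.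

Definition bounded_tuple T := forall i, bounded_op (T i).

Definition commuting T := forall i j x, T i (T j x) = T j (T i x).

Definition Qop T X : H -> H := fun x => \sum_i adjoint (T i) (X (T i x)).

Definition spherical_contraction T :=
  [/\ bounded_tuple T, commuting T & op_le (Qop T id) id].

Definition jointly_left_invertible T :=
  [/\ bounded_tuple T, commuting T &
      exists2 c : R, 0 < c & op_le (fun x => c%:C%C *: x) (Qop T id)].

Definition spherical_cauchy_dual T : 'I_d -> H -> H :=
  fun i => T i \o op_inv (Qop T id).

Definition joint_complete_hyperexpansion T :=
  bounded_tuple T /\
  forall n, (0 < n)%N ->
    op_le (fun x => \sum_(k < n.+1)
             ((-1) ^+ k * 'C(n, k)%:R) *: iter k (Qop T) id x)
          (fun=> 0).

Definition normal_op X :=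
  bounded_op X /\ adjoint X \o X = X \o adjoint X.

End operators.

(* The inclusion of H in K is an isometric linear embedding V. *)
Definition subnormal (R : realType) (H : hilbertSpace R) (d : nat)
    (T : 'I_d -> H -> H) :=
  [/\ bounded_tuple T, commuting T &
    exists (K : hilbertSpace R) (V : H -> K) (N : 'I_d -> K -> K),
      [/\ linear V, isometry (hform K) (hform H) V,
          forall i, normal_op (N i), commuting N &
          forall i x, N i (V x) = V (T i x)]].

Section multi_index.
Variables (R : realType) (d : nat).

Definition mindex := {ffun 'I_d -> nat}.

Definition mdegree (a : mindex) : nat := (\sum_i a i)%N.

Definition Cd := 'rV[R[i]^o]_d.

Definition monomial (z : Cd) (a : mindex) : R[i] :=
  \prod_i (z 0 i : R[i]) ^+ a i.

Definition sqmod (z : Cd) : R := \sum_i normc (z 0 i) ^+ 2.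

Definition ball_Cd : set Cd := [set z | sqmod z < 1].

Definition sphere_Cd : set Cd := [set z | sqmod z = 1].

Definition torus_Cd : set Cd := [set z | forall i, normc (z 0 i) = 1].

Definition borel_Cd := g_sigma_algebraType (@open Cd).

Definition rotate (t z : Cd) : Cd :=
  \row_i ((t 0 i : R[i]) * (z 0 i : R[i])).

Definition reinhardt (nu : {finite_measure set borel_Cd -> \bar R}) :=
  nu (~` sphere_Cd) = 0%E /\
  forall t, torus_Cd t -> forall A : set borel_Cd, measurable A ->
    nu (rotate t @^-1` A) = nu A.

(* k-th coefficient of the one-variable series f_z(zeta) = f(zeta z) *)
Definition slice (f : mindex -> R[i]) (z : Cd) : nat -> R[i] :=
  fun k => \sum_(a \in [set a : mindex | mdegree a = k]) f a * monomial z a.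

Definition slice_representation (beta : mindex -> {posnum R})
    (nu : {finite_measure set borel_Cd -> \bar R}) (gamma : nat -> {posnum R}) :=
  (forall f : mindex -> R[i], f \in sqsummable beta ->
     sqnorm beta f =
       \int[nu]_(z in (sphere_Cd : set borel_Cd)) sqnorm gamma (slice f z))%E /\
  (forall a, ((beta a)%:num%:E =
     (gamma (mdegree a))%:num%:E *
       'N[nu]_(2%:E)[EFin \o (fun z : borel_Cd => normc (monomial z a))])%E).

Definition spherically_balanced (beta : mindex -> {posnum R}) :=
  exists (nu : {finite_measure set borel_Cd -> \bar R}) (gamma : nat -> {posnum R}),
    reinhardt nu /\ slice_representation beta nu gamma.

(* The formal product z_i * f *)
Definition coord_mul (i : 'I_d) (f : mindex -> R[i]) : mindex -> R[i] :=
  fun a => if (0 < a i)%N then f [ffun j => (a j - (j == i))%N] else 0.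

Definition multiplication_tuple (beta : mindex -> {posnum R})
    (T : 'I_d -> H2space beta -> H2space beta) :=
  forall i (f : H2 beta), coefs (T i f) = coord_mul i (coefs f).

(* The kernel sum_a (kcoef K a) z^a conj(w)^a, required to converge on the ball;
   kernel_fun is the function of (z, w), and rkhs K is its reproducing kernel
   Hilbert space of power series, see reproducing. *)
Record diag_kernel := Kernel {
  kcoef : mindex -> {posnum R};
  kernel_summable : forall z w, ball_Cd z -> ball_Cd w ->
    csummable (fun a => ((kcoef a)%:num)%:C%C * monomial z a * (monomial w a)^*)
}.

Definition kernel_fun (K : diag_kernel) (z w : Cd) : R[i] :=
  csum (fun a => ((kcoef K a)%:num)%:C%C * monomial z a * (monomial w a)^*).

Definition kernel_weight (K : diag_kernel) : mindex -> {posnum R} :=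
  fun a => (Num.sqrt ((kcoef K a)%:num)^-1)%:pos.

Definition rkhs (K : diag_kernel) : hilbertSpace R := H2space (kernel_weight K).

Lemma kernel_add_summable (K1 K2 : diag_kernel) z w : ball_Cd z -> ball_Cd w ->
  csummable (fun a => ((((kcoef K1 a)%:num + (kcoef K2 a)%:num)%:pos)%:num)%:C%C *
    monomial z a * (monomial w a)^*).
Proof.
move=> Bz Bw.
have := csummableD (kernel_summable K1 Bz Bw) (kernel_summable K2 Bz Bw).
by congr csummable; apply/funext => a; rewrite /= rmorphD/= !mulrDl.
Qed.

Definition kernel_add (K1 K2 : diag_kernel) : diag_kernel :=
  Kernel (@kernel_add_summable K1 K2).

Lemma kernel_addE (K1 K2 : diag_kernel) z w : ball_Cd z -> ball_Cd w ->
  kernel_fun (kernel_add K1 K2) z w = kernel_fun K1 z w + kernel_fun K2 z w.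
Proof.
move=> Bz Bw; rewrite /kernel_fun -csumD; [|exact: kernel_summable..].
by congr csum; apply/funext => a; rewrite /= rmorphD/= !mulrDl.
Qed.

Lemma kernel_section_subproof (K : diag_kernel) w : ball_Cd w ->
  (fun a => ((kcoef K a)%:num)%:C%C * (monomial w a)^*)
    \in sqsummable (kernel_weight K).
Proof.
move=> Bw; apply/sqsummableP; have := kernel_summable K Bw Bw.
rewrite /csummable; congr rsummable; apply/funext => a.
rewrite !normcM normc_conj normc_real gtr0_norm//= sqr_sqrtr ?invr_ge0//.
by field; rewrite gt_eqF.
Qed.

Definition kernel_section (K : diag_kernel) w (Bw : ball_Cd w) : rkhs K :=
  MkH2 (kernel_section_subproof K Bw).

Lemma reproducing (K : diag_kernel) w (Bw : ball_Cd w) (f : H2 (kernel_weight K)) :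
  hform (rkhs K) f (kernel_section K Bw) = csum (fun a => f a * monomial w a).
Proof.
congr csum; apply/funext => a /=.
rewrite rmorphM/= conjCK sqr_sqrtr ?invr_ge0//.
rewrite (_ : conjC _ = ((kcoef K a)%:num)%:C%C); last first.
  by rewrite /conjC /= oppr0.
rewrite [_%:C%C * _]mulrC mulrA -[RHS]mulr1 -mulrA; congr (_ * _).
by rewrite -rmorphM/= mulfV ?gt_eqF.
Qed.

Definition balanced_kernel (K : diag_kernel) :=
  spherically_balanced (kernel_weight K).

(* A multiplication tuple, if it exists, is unique since coefs is injective. *)
Definition class_K (nu : {finite_measure set borel_Cd -> \bar R}) (K : diag_kernel) :=
  [/\ balanced_kernel K,
      exists gamma, slice_representation (kernel_weight K) nu gamma &
      exists Mz : 'I_d -> rkhs K -> rkhs K,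
        [/\ multiplication_tuple Mz, bounded_tuple Mz,
            jointly_left_invertible Mz &
            joint_complete_hyperexpansion (spherical_cauchy_dual Mz)]].

End multi_index.

(* Main.v *)
Require Import Defs.
From HB Require Import structures.
From mathcomp Require Import all_boot all_order all_algebra finmap.
From mathcomp Require Import all_classical all_reals all_analysis.
From mathcomp Require Import measurable_realfun.
From mathcomp Require Import complex ring lra zify.

(** Write k = |a|, and let n_a be the integral of |z^a|^2 against nu. A member
    of the class has squared weights gamma_k^2 n_a. Since the |z_i|^2 sum to 1
    on the sphere, n_a is the sum over i of n_{a + e_i} ([moment_sum]), so the
    map X |-> sum_i T_i^* X T_i preserves the operators that act on each z^a by
    a scalar depending on k only ([Qop_radial]). Computing the iterates for the
    Cauchy dual shows that its complete hyperexpansivity makes the sequence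
    1/gamma_k^2 completely alternating ([hyperexpansion_alternating]).

    The kernel coefficients are (1/gamma_k^2)/n_a, so adding two kernels of the
    class adds these sequences. Hence the space of K1 + K2 has squared weights
    G_k n_a, where 1/G is positive and completely alternating, and then G is
    completely monotone ([completely_monotoneV]). In particular G is
    nonincreasing, which makes the multiplication tuple a spherical contraction.

    For subnormality, the normal extension lives on a space spanned by vectors
    that play the role of z^a conj(z)^b, with the inner products that a
    torus-invariant measure would give them: the pairing of z^a conj(z)^b and
    z^a' conj(z)^b' is G_k n_{a + b'} with k = |a + b'| when a + b' = a' + b,
    and 0 otherwise ([mixed_kernel]). Such a space exists as soon as this kernel
    is positive semidefinite ([kernel_realization], an infinite Cholesky
    factorization). Without the factor G this follows by integrating a
    kernel that is positive for each z ([moment_psd]). As for the factor,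
    Bernstein's weights exhibit G_k as a limit of nonnegative combinations of
    powers tau^k with 0 <= tau ([hausdorff_moment_cvg]), and a factor tau^k only
    rescales the vectors ([psd_mixed_kernel_monotone]). Multiplication by z_i and
    by conj(z_i) acts on the spanning vectors by index shifts, which commute with
    each other and are formally adjoint. They are bounded because the kernel
    minus its shift is again positive semidefinite, by complete monotonicity of
    the differences of G ([weight_kernel_contraction]), so they extend to
    commuting normal operators by density ([bounded_extension]). *)

Set Implicit Arguments.
Unset Strict Implicit.
Unset Printing Implicit Defensive.

Import Order.TTheory GRing.Theory Num.Theory Num.Def.
Import ComplexField.Normc.
Import numFieldNormedType.Exports.

Local Open Scope classical_set_scope.
Local Open Scope ring_scope.

Local Notation Re := complex.Re.
Local Notation Im := complex.Im.

(** * Completely monotone and completely alternating sequences *)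

Section monotone_sequences.
Variable R : realType.
Implicit Types (f g c : nat -> R) (n m k j : nat).

Definition nabla f : nat -> R := fun k => f k - f k.+1.

Lemma iter_nablaS n f k :
  iter n.+1 nabla f k = iter n nabla f k - iter n nabla f k.+1.
Proof. by []. Qed.

Lemma iter_nablaE n f k :
  iter n nabla f k = \sum_(m < n.+1) (-1) ^+ m * 'C(n, m)%:R * f (k + m)%N.
Proof.
elim: n k => [|n IH] k; first by rewrite big_ord1 /= mul1r mul1r addn0.
rewrite iter_nablaS !IH big_ord_recl [in RHS]big_ord_recl /=.
rewrite !bin0 !mul1r !addn0 -addrA; congr (_ + _).
rewrite [in RHS](eq_bigr (fun i : 'I_n.+1 =>
    (-1) ^+ i.+1 * 'C(n, i.+1)%:R * f (k + i.+1)%N +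
    - ((-1) ^+ i * 'C(n, i)%:R * f (k.+1 + i)%N))); last first.
  by move=> i _; rewrite /bump /= add1n binS natrD addSnnS exprS; ring.
rewrite big_split /= sumrN; congr (_ - _).
by rewrite [in RHS]big_ord_recr /= bin_small// mulr0 mul0r addr0.
Qed.

(** The expansion of (nabla + E)^n = 1, where E is the shift of sequences and
    commutes with nabla. *)
Lemma nabla_expansion n f k :
  f k = \sum_(i < n.+1) 'C(n, i)%:R * iter (n - i) nabla f (k + i)%N.
Proof.
elim: n => [|n IH]; first by rewrite big_ord1 /= mul1r addn0.
rewrite IH; transitivity (\sum_(i < n.+1)
   ('C(n, i)%:R * iter (n.+1 - i) nabla f (k + i)%N +
    'C(n, i)%:R * iter (n - i) nabla f (k + i.+1)%N)).
  apply: eq_bigr => i _; rewrite -mulrDr subSn ?leq_ord// iter_nablaS.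
  by rewrite addnS subrK.
rewrite big_split /= [in RHS]big_ord_recl.
rewrite [X in X + _ = _]big_ord_recl /= !bin0 -addrA; congr (_ + _).
rewrite [in RHS](eq_bigr (fun i : 'I_n.+1 =>
    'C(n, i.+1)%:R * iter (n.+1 - i.+1) nabla f (k + i.+1)%N +
    'C(n, i)%:R * iter (n - i) nabla f (k + i.+1)%N)); last first.
  by move=> i _; rewrite /bump /= add1n binS natrD mulrDl subSS.
rewrite big_split /=; congr (_ + _).
by rewrite [in RHS]big_ord_recr /= bin_small// mul0r addr0.
Qed.

(** The finite-order version is what inductions on the order can use: by
    [monotone_uptoS] it unfolds one order at a time. *)
Definition monotone_upto n f := forall m k, (m <= n)%N -> 0 <= iter m nabla f k.

Definition completely_monotone f := forall m k, 0 <= iter m nabla f k.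

Definition completely_alternating f :=
  forall m k, (0 < m)%N -> iter m nabla f k <= 0.

Lemma monotone_uptoS n f :
  monotone_upto n.+1 f <-> (forall k, 0 <= f k) /\ monotone_upto n (nabla f).
Proof.
split=> [h|[h0 h1] [|m] k mn].
- split=> [k|m k mn]; first exact: (h 0%N).
  by rewrite -iterSr; exact: h.
- exact: h0.
- by rewrite iterSr; exact: h1.
Qed.

Lemma monotone_uptoW n f : monotone_upto n.+1 f -> monotone_upto n f.
Proof. by move=> h m k mn; apply: h; exact: leqW. Qed.

Lemma iter_nabla_shift n f k :
  iter n nabla (fun k => f k.+1) k = iter n nabla f k.+1.
Proof. by elim: n k => // n IH k; rewrite !iter_nablaS !IH. Qed.

Lemma monotone_upto_shift n f :
  monotone_upto n f -> monotone_upto n (fun k => f k.+1).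
Proof. by move=> h m k mn; rewrite iter_nabla_shift; exact: h. Qed.

Lemma iter_nablaD n f g k : iter n nabla (fun k => f k + g k) k =
  iter n nabla f k + iter n nabla g k.
Proof. by elim: n k => // n IH k; rewrite !iter_nablaS !IH; ring. Qed.

Lemma iter_nablaN n f k : iter n nabla (fun k => - f k) k = - iter n nabla f k.
Proof. by elim: n k => // n IH k; rewrite !iter_nablaS !IH; ring. Qed.

(** The discrete Leibniz rule; the shift of f in the second term is why
    [monotone_upto_shift] is needed for products. *)
Lemma nablaM f g : nabla (fun k => f k * g k) =
  (fun k => nabla f k * g k + f k.+1 * nabla g k).
Proof. by apply/funext => k; rewrite /nabla; ring. Qed.

Lemma monotone_uptoM n f g : monotone_upto n f -> monotone_upto n g ->
  monotone_upto n (fun k => f k * g k).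
Proof.
elim: n f g => [|n IH] f g hf hg.
  by case=> // k _; rewrite mulr_ge0 ?(hf 0%N) ?(hg 0%N).
have [f0 hf'] := (monotone_uptoS n f).1 hf.
have [g0 hg'] := (monotone_uptoS n g).1 hg.
apply/monotone_uptoS; split=> [k|m k mn]; first by rewrite mulr_ge0.
rewrite nablaM iter_nablaD addr_ge0//.
  by apply: IH mn => //; exact: monotone_uptoW.
by apply: IH mn => //; apply/monotone_upto_shift/monotone_uptoW.
Qed.

(** The difference of 1/c is (- nabla c) * (1/c) * (E (1/c)), with E the shift:
    a product of - nabla c, which is completely monotone, and of two sequences
    whose differences up to order n are known to be nonnegative when order n + 1
    is treated. *)
Lemma completely_monotoneV c : (forall k, 0 < c k) -> completely_alternating c ->
  completely_monotone (fun k => (c k)^-1).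
Proof.
move=> c0 ca m k; suff: monotone_upto m (fun k => (c k)^-1) by apply.
elim: m {k} => [|n IH]; first by case=> // k _; rewrite invr_ge0 ltW.
apply/monotone_uptoS; split=> [k|]; first by rewrite invr_ge0 ltW.
have -> : nabla (fun k => (c k)^-1) =
    (fun k => - nabla c k * (c k)^-1 * (c k.+1)^-1).
  apply/funext => k; rewrite /nabla.
  by field; rewrite !gt_eqF.
apply: monotone_uptoM (monotone_upto_shift IH).
apply: monotone_uptoM IH => m k mn.
by rewrite iter_nablaN -iterSr oppr_ge0 ca.
Qed.

(** The value that the functional t^k |-> f_k would take on the Bernstein
    polynomial C(n, j) t^j (1 - t)^(n - j). *)
Definition bernstein_weight f n j : R := 'C(n, j)%:R * iter (n - j) nabla f j.

Lemma bernstein_weight_ge0 f n j :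
  completely_monotone f -> 0 <= bernstein_weight f n j.
Proof. by move=> cf; rewrite mulr_ge0. Qed.

(** [nabla_expansion] of length n - k, written over j = i + k: the coefficient
    C(n - k, j - k) equals C(n, j) C(j, k) / C(n, k). *)
Lemma sum_bernstein_weight f n k : (k <= n)%N ->
  f k = \sum_(j < n.+1) bernstein_weight f n j * ('C(j, k)%:R / 'C(n, k)%:R).
Proof.
move=> kn; rewrite (nabla_expansion (n - k) f k).
rewrite [RHS](eq_bigr (fun j : 'I_n.+1 => (fun j : nat => bernstein_weight f n j *
   ('C(j, k)%:R / 'C(n, k)%:R)) j))//.
rewrite -(big_mkord xpredT (fun j => bernstein_weight f n j *
   ('C(j, k)%:R / 'C(n, k)%:R))).
rewrite (big_cat_nat (leq0n k))/=; last by rewrite leqW.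
rewrite [X in _ = X + _](_ : _ = 0) ?add0r; last first.
  by rewrite big_nat; apply: big1 => i /andP[_ ik]; rewrite bin_small// mul0r mulr0.
rewrite -[X in \sum_(X <= _ < _) _]add0n big_addn subSn// big_mkord.
apply: eq_bigr => i _; rewrite /bernstein_weight (addnC i k).
rewrite mulrAC subnDA; congr (_ * _).
have in_ : (i <= n - k)%N by rewrite -ltnS.
have C0 : ('C(n, k)%:R : R) != 0 by rewrite pnatr_eq0 -lt0n bin_gt0.
apply: (mulIf C0); rewrite mulrA mulfVK// -!natrM; congr _%:R.
have kin : (k + i <= n)%N by rewrite -leq_subRL.
apply/eqP; rewrite -(eqn_pmul2r (fact_gt0 i)) -(eqn_pmul2r (fact_gt0 k)).
rewrite -(eqn_pmul2r (fact_gt0 (n - k - i))).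
have e1 := bin_fact kn; have e2 := bin_fact in_; have e3 := bin_fact kin.
have e4 := bin_fact (leq_addr i k).
rewrite addKn in e4; rewrite subnDA in e3; apply/eqP.
transitivity (n`!).
  by rewrite -e1 -e2; ring.
by rewrite -e3 -e4; ring.
Qed.

(** Induction on k: the ratio for k + 1 is the ratio for k times
    (j - k) / (n - k), which differs from j / n by at most k / n. *)
Lemma bin_ratio_approx n j k : (j <= n)%N -> (k <= n)%N -> (0 < n)%N ->
  `| 'C(j, k)%:R / 'C(n, k)%:R - (j%:R / n%:R) ^+ k | <= k%:R ^+ 2 / n%:R :> R.
Proof.
move=> jn kn n0; have n0R : 0 < n%:R :> R by rewrite ltr0n.
set x : R := j%:R / n%:R.
have x0 : 0 <= x by rewrite divr_ge0.
have x1 : x <= 1 by rewrite ler_pdivrMr// mul1r ler_nat.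
have r01 i : (i <= n)%N -> 0 <= ('C(j, i)%:R / 'C(n, i)%:R : R) <= 1.
  move=> ik; rewrite divr_ge0//= ler_pdivrMr ?ltr0n ?bin_gt0//.
  by rewrite mul1r ler_nat leq_bin2l.
elim: k kn => [_|k IH kn].
  by rewrite !bin0 divr1 expr0 subrr normr0 expr0n mul0r.
have kn' := ltnW kn.
have nk0 : 0 < (n - k)%:R :> R by rewrite ltr0n subn_gt0.
(* truncated subtraction: y = 0 when j < k, as it should *)
pose y : R := (j - k)%:R / (n - k)%:R.
have rS : 'C(j, k.+1)%:R / 'C(n, k.+1)%:R = 'C(j, k)%:R / 'C(n, k)%:R * y :> R.
  have C0 : ('C(n, k)%:R : R) != 0 by rewrite pnatr_eq0 -lt0n bin_gt0.
  have C1 : ('C(n, k.+1)%:R : R) != 0 by rewrite pnatr_eq0 -lt0n bin_gt0.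
  have nk := lt0r_neq0 nk0.
  apply: (mulIf C1); rewrite mulfVK//.
  have k1 : (k.+1%:R : R) != 0 by rewrite pnatr_eq0.
  apply: (mulfI k1); rewrite -natrM mul_bin_left natrM.
  rewrite [RHS](_ : _ =
    'C(j, k)%:R / 'C(n, k)%:R * y * (k.+1 * 'C(n, k.+1))%:R); last first.
    by rewrite natrM; ring.
  rewrite mul_bin_left natrM /y; field.
  by rewrite nk C0.
have yx : `|y - x| <= k%:R / n%:R.
  have kn0 : (n - k)%:R = n%:R - k%:R :> R by rewrite natrB.
  have kR : 0 <= k%:R :> R by [].
  have jR : j%:R <= n%:R :> R by rewrite ler_nat.
  case: (leqP k j) => kj; last first.
    rewrite /y (eqP (ltnW kj : j - k == 0)%N) mul0r sub0r normrN ger0_norm//.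
    by rewrite ler_pM2r ?invr_gt0// ler_nat ltnW.
  have kjR : k%:R <= j%:R :> R by rewrite ler_nat.
  rewrite /y /x natrB// kn0; rewrite kn0 in nk0.
  have -> : (j%:R - k%:R) / (n%:R - k%:R) - j%:R / n%:R =
      - (k%:R / n%:R * ((n%:R - j%:R) / (n%:R - k%:R))) :> R.
    by field; rewrite !gt_eqF.
  have d0 : 0 <= (n%:R - j%:R) / (n%:R - k%:R) :> R.
    by rewrite divr_ge0 ?(ltW nk0)// subr_ge0.
  rewrite normrN ger0_norm; last by rewrite mulr_ge0// divr_ge0.
  by rewrite ler_piMr ?divr_ge0// ler_pdivrMr// mul1r lerB.
have [r0 r1] := andP (r01 k kn').
rewrite rS exprSr; set r : R := _ / _ in r0 r1 IH *.
have -> : r * y - x ^+ k * x = r * (y - x) + x * (r - x ^+ k) by ring.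
apply: (le_trans (ler_normD _ _)).
rewrite (normrM r) (normrM x) (ger0_norm r0) (ger0_norm x0).
apply: (@le_trans _ _ (1 * (k%:R / n%:R) + 1 * (k%:R ^+ 2 / n%:R))).
  by apply: lerD; apply: ler_pM => //; exact: IH.
rewrite !mul1r -mulrDl ler_pM2r ?invr_gt0// -natr1.
have : 0 <= k%:R :> R by [].
by rewrite sqrrD expr1n mulr1; lra.
Qed.

(** Hausdorff's solution of the moment problem on [0, 1]: f_k is the limit of the
    k-th moments of the point masses [bernstein_weight f n j] at j / n. *)
Lemma hausdorff_moment_cvg f k : completely_monotone f ->
  \sum_(j < n.+1) bernstein_weight f n j * (j%:R / n%:R) ^+ k @[n --> \oo] --> f k.
Proof.
move=> cf; have f0 := cf 0%N 0%N; rewrite /= in f0.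
have cv : f 0%N * k%:R ^+ 2 * (n%:R^-1 : R) @[n --> \oo] --> (0 : R).
  rewrite -[X in _ --> X](mulr0 (f 0%N * k%:R ^+ 2)); apply: cvgMr.
  by rewrite -cvg_shiftS; exact: cvg_harmonic.
apply/cvgrPdist_le => e e0.
move/cvgrPdist_le: cv => /(_ e e0) cv.
near=> n; have n0 : (0 < n)%N by near: n; exists 1%N.
have kn : (k <= n)%N by near: n; exists k.
have : `|0 - f 0%N * k%:R ^+ 2 * n%:R^-1| <= e by near: n.
rewrite sub0r normrN; apply: le_trans.
rewrite {1}(sum_bernstein_weight f kn) -sumrB.
apply: (le_trans (ler_norm_sum _ _ _)).
rewrite [leRHS]ger0_norm; last by rewrite !mulr_ge0 ?invr_ge0 ?sqr_ge0.
rewrite {1}(sum_bernstein_weight f (leq0n n)) !mulr_suml; apply: ler_sum => j _.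
have := bernstein_weight_ge0 n j cf; move: (bernstein_weight f n j) => b b0.
rewrite -mulrBr normrM ger0_norm// -!mulrA; apply: ler_wpM2l => //.
by rewrite !bin0 invr1 !mul1r mulrA -expr2; apply: bin_ratio_approx => //; rewrite -ltnS.
Unshelve. all: by end_near.
Qed.

End monotone_sequences.

(** * Hilbert spaces and extension of operators by density *)

Section hilbert_basics.
Variables (R : realType) (H : hilbertSpace R).
Implicit Types (x y z : H) (a : R[i]).

Lemma hformDl x y z : hform H (x + y) z = hform H x z + hform H y z.
Proof. exact: linearDl. Qed.

Lemma hformBl x y z : hform H (x - y) z = hform H x z - hform H y z.
Proof. exact: linearBl. Qed.

Lemma hformZl a x z : hform H (a *: x) z = a * hform H x z.
Proof. exact: linearZl_LR. Qed.

Lemma hformDr x y z : hform H z (x + y) = hform H z x + hform H z y.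
Proof. exact: linearDr. Qed.

Lemma hformBr x y z : hform H z (x - y) = hform H z x - hform H z y.
Proof. exact: linearBr. Qed.

Lemma hformZr a x z : hform H z (a *: x) = a^* * hform H z x.
Proof. exact: linearZr_LR. Qed.

Lemma hformC x y : hform H x y = (hform H y x)^*.
Proof. by rewrite [LHS]hermC expr0 mul1r. Qed.

Lemma hform0l x : hform H 0 x = 0. Proof. exact: linear0l. Qed.

Lemma hform0r x : hform H x 0 = 0. Proof. exact: linear0r. Qed.

Lemma hform_ge0 x : 0 <= hform H x x.
Proof. exact: dnorm_ge0. Qed.

Lemma Re_ge0 (z : R[i]) : 0 <= z -> 0 <= Re z.
Proof. by rewrite lecE => /andP[]. Qed.

Lemma ge0_ReE (z : R[i]) : 0 <= z -> z = (Re z)%:C%C.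
Proof. by case: z => a b; rewrite lecE /= => /andP[/eqP ->]. Qed.

Lemma hnorm_ge0 x : 0 <= hnorm x. Proof. exact: sqrtr_ge0. Qed.

Lemma sqr_hnorm x : hnorm x ^+ 2 = Re (hform H x x).
Proof. by rewrite sqr_sqrtr//; apply/Re_ge0/hform_ge0. Qed.

Lemma hformxx x : hform H x x = (hnorm x ^+ 2)%:C%C.
Proof. by rewrite sqr_hnorm; apply/ge0_ReE/hform_ge0. Qed.

Lemma hnorm0 : hnorm (0 : H) = 0.
Proof. by rewrite /hnorm /form_norm hform0l /= sqrtr0. Qed.

Lemma hnorm_eq0 x : hnorm x = 0 -> x = 0.
Proof.
move=> x0; apply/eqP; apply: contraT => /(@neq0_dnorm_gt0 _ _ _ (hform H)).
by rewrite [X in 0 < X]hformxx x0 expr0n ltxx.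
Qed.

Lemma mul_normc_conj a : a * a^* = (normc a ^+ 2)%:C%C.
Proof. by rewrite -normCK rmorphXn. Qed.

Lemma conj_real (r : R) : (r%:C%C)^* = r%:C%C :> R[i].
Proof. by rewrite /conjC /= oppr0. Qed.

Lemma hnormZ a x : hnorm (a *: x) = normc a * hnorm x.
Proof.
apply/eqP; rewrite -(eqrXn2 (n := 2))//; last 2 first.
- exact: hnorm_ge0.
- by rewrite mulr_ge0 ?normc_ge0 ?hnorm_ge0.
apply/eqP/complexI; rewrite -hformxx hformZl hformZr mulrA mul_normc_conj.
by rewrite hformxx -rmorphM exprMn.
Qed.

Lemma hnormN x : hnorm (- x) = hnorm x.
Proof. by rewrite -scaleN1r hnormZ normcN normc1 mul1r. Qed.

Lemma hnormBC x y : hnorm (x - y) = hnorm (y - x).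
Proof. by rewrite -hnormN opprB. Qed.

(** Expand 0 <= <u, u> for u = <y, y> x - <x, y> y, the multiple of the
    component of x orthogonal to y that avoids a division. *)
Lemma cauchy_schwarz x y : normc (hform H x y) <= hnorm x * hnorm y.
Proof.
have [->|y0] := eqVneq y 0.
  by rewrite hform0r normc0 mulr_ge0 ?hnorm_ge0.
have yy0 : 0 < hnorm y.
  rewrite lt_neqAle hnorm_ge0 andbT eq_sym; apply: contra y0 => /eqP/hnorm_eq0 ->.
  by [].
rewrite -(@ler_pXn2r _ 2)// ?nnegrE; last 2 first.
- exact: normc_ge0.
- by rewrite mulr_ge0 ?hnorm_ge0.
set a := hform H x y; set u := (hnorm y ^+ 2)%:C%C *: x - a *: y.
have : 0 <= hform H u u by exact: hform_ge0.
have aC : hform H y x = a^* by rewrite hformC.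
rewrite /u !(hformBl, hformBr, hformZl, hformZr) !hformxx -/a aC conj_real.
have aa := mul_normc_conj a.
have e (p q : R) : p%:C%C * (p%:C%C * q%:C%C - a^* * a) -
    (a * (p%:C%C * a^*) - a * (a^* * p%:C%C)) = (p * (p * q - normc a ^+ 2))%:C%C.
  by rewrite rmorphM rmorphB /= rmorphM /= -aa; ring.
rewrite [X in 0 <= X](_ : _ = (hnorm y ^+ 2 *
    (hnorm y ^+ 2 * hnorm x ^+ 2 - normc a ^+ 2))%:C%C); last first.
  by rewrite -e; ring.
by rewrite lecR pmulr_rge0 ?exprn_gt0// subr_ge0 exprMn mulrC.
Qed.

Lemma hnormD x y : hnorm (x + y) <= hnorm x + hnorm y.
Proof.
rewrite -(@ler_pXn2r _ 2)// ?nnegrE ?addr_ge0 ?hnorm_ge0//.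
rewrite sqr_hnorm hformDl !hformDr !hformxx [hform H y x]hformC.
have := le_trans (ler_norm _) (le_trans (le_Re_normc _) (cauchy_schwarz x y)).
case: (hform H x y) => r s /= h.
by rewrite sqrrD; lra.
Qed.

Lemma hnormB x y : hnorm (x - y) <= hnorm x + hnorm y.
Proof. by rewrite -[hnorm y]hnormN; exact: hnormD. Qed.

Lemma eq_hform x y : (forall z, hform H x z = hform H y z) -> x = y.
Proof.
move=> xy; apply/eqP; rewrite -subr_eq0 -(dnorm_eq0 (hform H)).
by rewrite [X in X == 0]hformBl xy subrr.
Qed.

End hilbert_basics.

Section linear_span.
Variables (R : realType).

(** Finite linear combinations are lists of coefficients and indices, so that
    no linear independence or finite support has to be tracked. *)
Definition lincomb (V : lmodType R[i]) (S : Type) (phi : S -> V)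
  (l : seq (R[i] * S)) : V := \sum_(p <- l) p.1 *: phi p.2.

Definition densely_spanning (H : hilbertSpace R) (S : Type) (phi : S -> H) :=
  forall x (e : R), 0 < e -> exists l, hnorm (x - lincomb phi l) < e.

(** The predicate [bounded_op], for a map between two different spaces. *)
Definition bounded_linear (H K : hilbertSpace R) (X : H -> K) :=
  linear X /\ exists M : R, forall x, hnorm (X x) <= M * hnorm x.

Definition scale_comb (S : Type) (a : R[i]) (l : seq (R[i] * S)) :=
  [seq (a * p.1, p.2) | p <- l].

Lemma lincomb_cat (V : lmodType R[i]) S (phi : S -> V) l m :
  lincomb phi (l ++ m) = lincomb phi l + lincomb phi m.
Proof. exact: big_cat. Qed.

Lemma lincombZ (V : lmodType R[i]) S (phi : S -> V) a l :
  lincomb phi (scale_comb a l) = a *: lincomb phi l.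
Proof.
rewrite /lincomb big_map scaler_sumr; apply: eq_bigr => p _.
by rewrite scalerA.
Qed.

Lemma lincomb1 (V : lmodType R[i]) S (phi : S -> V) s :
  lincomb phi [:: (1, s)] = phi s.
Proof. by rewrite /lincomb big_seq1 scale1r. Qed.

(** An operator prescribed on a spanning family extends as soon as the
    prescription is bounded on linear combinations: the closure of its graph is
    a linear relation that is everywhere defined by completeness, and
    single-valued by the bound. *)
Lemma bounded_extension (H K : hilbertSpace R) (S : Type)
    (phi : S -> H) (psi : S -> K) (M : R) :
  densely_spanning phi ->
  (forall l, hnorm (lincomb psi l) <= M * hnorm (lincomb phi l)) ->
  exists X : H -> K, bounded_linear X /\ forall s, X (phi s) = psi s.
Proof.
move=> dphi; wlog M0 : M / 0 <= M => [hw|] hM.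
  apply: (hw `|M|) => // l; apply: (le_trans (hM l)).
  by rewrite ler_wpM2r ?hnorm_ge0// ler_norm.
(* closure of the graph of the map sending lincomb phi l to lincomb psi l *)
pose graph x y := forall e : R, 0 < e -> exists l,
  hnorm (x - lincomb phi l) < e /\ hnorm (y - lincomb psi l) < e.
have graph_le x y : graph x y -> hnorm y <= M * hnorm x.
  move=> xy; apply/ler_addgt0Pr => e e0.
  have M10 : 0 < M + 1 by rewrite ltr_wpDl.
  have [l [hx hy]] := xy _ (divr_gt0 e0 M10).
  have yE : y = (y - lincomb psi l) + lincomb psi l by rewrite subrK.
  have h1 : hnorm (lincomb phi l) <= hnorm x + e / (M + 1).
    have -> : lincomb phi l = x - (x - lincomb phi l) by rewrite subKr.
    by apply: (le_trans (hnormB _ _)); rewrite lerD2l ltW.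
  rewrite yE; apply: (le_trans (hnormD _ _)).
  apply: (le_trans (lerD (ltW hy) (hM l))).
  apply: (le_trans (lerD (lexx _) (ler_wpM2l M0 h1))).
  by rewrite le_eqVlt; apply/orP; left; apply/eqP; field; rewrite gt_eqF.
have graphP a x y x' y' :
    graph x y -> graph x' y' -> graph (a *: x + x') (a *: y + y').
  move=> xy xy' e e0.
  have n0 : 0 < normc a + 1 by rewrite ltr_wpDl ?normc_ge0.
  have e1 : 0 < e / 2 / (normc a + 1) by rewrite !divr_gt0.
  have e2 : 0 < e / 2 by rewrite divr_gt0.
  have [l [hx hy]] := xy _ e1; have [l' [hx' hy']] := xy' _ e2.
  exists (scale_comb a l ++ l'); rewrite !lincomb_cat !lincombZ.
  have aux (L : hilbertSpace R) (u u' v v' : L) :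
      hnorm (u - v) < e / 2 / (normc a + 1) -> hnorm (u' - v') < e / 2 ->
      hnorm (a *: u + u' - (a *: v + v')) < e.
    move=> h h'; rewrite opprD addrACA -scalerBr.
    apply: (le_lt_trans (hnormD _ _)); rewrite hnormZ.
    rewrite [e in _ < e](splitr e); apply: ler_ltD => //.
    apply: (le_trans (ler_wpM2l (normc_ge0 _) (ltW h))).
    rewrite mulrCA mulrA -mulrA ler_piMr ?(ltW e2)//.
    by rewrite ler_pdivrMr// mul1r lerDl.
  by split; exact: aux.
have graph_ex x : exists y, graph x y.
  have /choice[l hl] n : exists l, hnorm (x - lincomb phi l) < n.+1%:R^-1.
    by apply: dphi; rewrite invr_gt0 ltr0n.
  have [|y hy] := @hilbert_complete _ K (fun n => lincomb psi (l n)).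
    move=> e e0.
    (* two combinations within 1/(N+1) of x are at distance at most 2/(N+1) *)
    have M20 : 0 < 2 * (M + 1) by rewrite mulr_gt0// ltr_wpDl.
    have d0 : 0 < e / (2 * (M + 1)) by rewrite divr_gt0.
    have [N hN] : exists N, forall n, (N <= n)%N -> n.+1%:R^-1 < e / (2 * (M + 1)).
      have := @cvg_harmonic R; move/cvgrPdist_lt => /(_ _ d0)[N _ hN].
      exists N => n Nn; have := hN n Nn; rewrite /= sub0r normrN ger0_norm//.
    exists N => m n Nm Nn.
    have -> : lincomb psi (l m) - lincomb psi (l n) =
        lincomb psi (l m ++ scale_comb (-1) (l n)).
      by rewrite lincomb_cat lincombZ scaleN1r.
    apply: (le_lt_trans (hM _)); rewrite lincomb_cat lincombZ scaleN1r.
    have -> : lincomb phi (l m) - lincomb phi (l n) =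
        (x - lincomb phi (l n)) - (x - lincomb phi (l m)).
      by rewrite opprB [RHS]addrC addrA subrK.
    apply: (@le_lt_trans _ _ (M * (e / (M + 1)))).
      apply: ler_wpM2l => //; apply: (le_trans (hnormB _ _)).
      have := ltW (lt_trans (hl m) (hN m Nm)).
      have := ltW (lt_trans (hl n) (hN n Nn)).
      move=> h1 h2; apply: (le_trans (lerD h1 h2)).
      rewrite le_eqVlt; apply/orP; left; apply/eqP; field.
      by rewrite gt_eqF// ltr_wpDl.
    by rewrite mulrCA gtr_pMr// ltr_pdivrMr ?ltr_wpDl// mul1r ltrDl.
  exists y => e e0; have [N hN] := hy e e0.
  have [N' hN'] : exists N, forall n, (N <= n)%N -> n.+1%:R^-1 < e.
    have := @cvg_harmonic R; move/cvgrPdist_lt => /(_ _ e0)[N' _ hN'].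
    exists N' => n Nn; have := hN' n Nn; rewrite /= sub0r normrN ger0_norm//.
  exists (l (maxn N N')); split.
    by apply: (lt_trans (hl _)); apply: hN'; exact: leq_maxr.
  by rewrite hnormBC; apply: hN; exact: leq_maxl.
have graph_inj x y y' : graph x y -> graph x y' -> y = y'.
  move=> h h'; have := graphP (-1) _ _ _ _ h h'.
  rewrite !scaleN1r addNr => /graph_le; rewrite hnorm0 mulr0 => h0.
  apply/eqP; rewrite eq_sym -subr_eq0 addrC; apply/eqP/hnorm_eq0/eqP.
  by rewrite eq_le h0 hnorm_ge0.
have [X hX] := choice graph_ex; exists X; split; first split.
- move=> a x y; apply: (graph_inj (a *: x + y)); first exact: hX.
  exact: graphP.
- by exists M => x; exact: graph_le.
- move=> s; apply: (graph_inj (phi s)); first exact: hX.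
  by move=> e e0; exists [:: (1, s)]; rewrite !lincomb1 !subrr !hnorm0.
Qed.

(** All identities between bounded operators below reduce to this one: they are
    checked on a spanning family. *)
Lemma dense_functional_eq0 (H : hilbertSpace R) (S : Type) (phi : S -> H)
    (f : H -> R[i]) (M : R) : densely_spanning phi ->
  (forall a x y, f (a *: x + y) = a * f x + f y) ->
  (forall x, normc (f x) <= M * hnorm x) ->
  (forall s, f (phi s) = 0) -> forall x, f x = 0.
Proof.
move=> dphi flin fM fphi x.
have f0 : f 0 = 0.
  by have := flin (-1) 0 0; rewrite scaler0 addr0 mulN1r addNr.
have fl l : f (lincomb phi l) = 0.
  by elim: l => [|p l IH]; rewrite /lincomb ?big_nil// big_cons flin fphi IH mulr0 addr0.
apply: eq0_normc; apply/eqP; rewrite eq_le normc_ge0 andbT.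
apply/ler_addgt0Pr => e e0; rewrite add0r.
have M0 : 0 < `|M| + 1 by rewrite ltr_wpDl.
have [l hl] := dphi x _ (divr_gt0 e0 M0).
have -> : f x = f (x - lincomb phi l).
  by rewrite addrC -scaleN1r flin fl mulr0 add0r.
apply: (le_trans (fM _)).
apply: (@le_trans _ _ ((`|M| + 1) * (e / (`|M| + 1)))); last first.
  by rewrite mulrCA divff ?mulr1// gt_eqF.
apply: (@le_trans _ _ (`|M| * hnorm (x - lincomb phi l))).
  by rewrite ler_wpM2r ?hnorm_ge0// ler_norm.
by apply: ler_pM; rewrite ?hnorm_ge0 ?lerDl ?ler01 ?(ltW hl).
Qed.

Lemma bounded_linearP (H K : hilbertSpace R) (X : H -> K) : bounded_linear X ->
  [/\ forall a x y, X (a *: x + y) = a *: X x + X y, X 0 = 0 &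
      exists2 M : R, 0 <= M & forall x, hnorm (X x) <= M * hnorm x].
Proof.
move=> [linX [M XM]]; split=> //.
  by have := linX (-1) 0 0; rewrite !scaler0 addr0 scaleN1r addNr.
exists `|M| => // x; apply: (le_trans (XM x)).
by rewrite ler_wpM2r ?hnorm_ge0// ler_norm.
Qed.

Lemma dense_sesquilinear_eq0 (H K : hilbertSpace R) (S T : Type)
    (phi : S -> H) (psi : T -> K) (f : H -> K -> R[i])
    (M : R) :
  densely_spanning phi -> densely_spanning psi ->
  (forall a x x' y, f (a *: x + x') y = a * f x y + f x' y) ->
  (forall a x y y', f x (a *: y + y') = a^* * f x y + f x y') ->
  (forall x y, normc (f x y) <= M * hnorm x * hnorm y) ->
  (forall s t, f (phi s) (psi t) = 0) -> forall x y, f x y = 0.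
Proof.
move=> dphi dpsi fl fr fM f0 x y.
have f1 t : f x (psi t) = 0.
  apply: (dense_functional_eq0 dphi (f := f^~ (psi t)) (M := M * hnorm (psi t))) => //.
  by move=> z; rewrite mulrAC.
have /(congr1 conjC) : (f x y)^* = 0.
  apply: (dense_functional_eq0 dpsi (f := fun y => (f x y)^*) (M := M * hnorm x)).
  - by move=> a z z'; rewrite fr rmorphD rmorphM /= conjCK.
  - by move=> z; rewrite normc_conj.
  - by move=> t; rewrite f1 conjC0.
by rewrite conjCK conjC0.
Qed.

End linear_span.

(** * Weighted sequence spaces and Gram matrices *)

Section operators_uniqueness.
Variables (R : realType) (H : hilbertSpace R).
Implicit Types X Y : H -> H.

Lemma adjoint_unique X Y : bounded_op Y ->
  (forall x y, hform H (X x) y = hform H x (Y y)) -> adjoint X = Y.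
Proof.
move=> bY XY; apply: xget_unique => // Z [bZ XZ].
apply/funext => y; apply: eq_hform => x.
by rewrite hformC -XZ XY -hformC.
Qed.

Lemma op_inv_unique X Y : bounded_op Y -> cancel X Y -> cancel Y X ->
  op_inv X = Y.
Proof.
move=> bY XY YX; apply: xget_unique => // Z [bZ XZ ZX].
by apply/funext => y; rewrite -{1}(YX y) XZ.
Qed.

End operators_uniqueness.

Lemma sum_if_eq (V : nmodType) (I : eqType) (s : seq I) (i : I) (c : V) :
  uniq s -> \sum_(j <- s) (if j == i then c else 0) = if i \in s then c else 0.
Proof.
move=> us; case: ifPn => js; last first.
  by rewrite big_seq big1// => j sj; case: eqP => // ij; rewrite -ij sj in js.
rewrite (bigD1_seq i js us) /=.
have -> : \sum_(j <- s | j != i) (if j == i then c else 0) = 0.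
  by apply: big1 => j /negbTE ->.
by rewrite addr0 eqxx.
Qed.

Section finite_sums.
Variables (R : realType) (I : choiceType).

Lemma mem_set1 (i j : I) : (j \in [set i]) = (j == i).
Proof. by apply/idP/eqP => [/set_mem//|->]; exact: mem_set. Qed.

Lemma rsummable_single (i : I) (c : R) :
  rsummable (fun j => if j == i then c else 0).
Proof.
rewrite /rsummable /summable.
rewrite (eq_esum (b := fun j => if j \in [set i] then `|c|%:E else 0%E)).
  by rewrite -esum_mkcond esum_set1 ?ltry// lee_fin.
by move=> j _; rewrite mem_set1 /=; case: eqP => _; rewrite ?normr0.
Qed.

Lemma rsum_single (i : I) (c : R) : rsum (fun j => if j == i then c else 0) = c.
Proof.
rewrite (_ : (fun j => _) = fun j => c * (if j == i then 1 else 0)).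
  rewrite rsumZ; last exact: rsummable_single.
  rewrite rsum_ge0; last exact: rsummable_single; last by move=> j; case: ifP.
  rewrite (eq_esum (b := fun j => if j \in [set i] then 1%E else 0%E)).
    by rewrite -esum_mkcond esum_set1 ?lee_fin//= mulr1.
  by move=> j _; rewrite mem_set1; case: eqP.
by apply/funext => j; case: ifP; rewrite ?mulr1 ?mulr0.
Qed.

Lemma csummable_single (i : I) (c : R[i]) :
  csummable (fun j => if j == i then c else 0).
Proof.
rewrite /csummable (_ : (fun j => _) = fun j => if j == i then normc c else 0).
  exact: rsummable_single.
by apply/funext => j; case: ifP; rewrite ?normc0.
Qed.

Lemma csum_single (i : I) (c : R[i]) : csum (fun j => if j == i then c else 0) = c.
Proof.
rewrite /csum.
rewrite (_ : (fun j => Re _) = fun j => if j == i then Re c else 0); last first.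
  by apply/funext => j; case: ifP.
rewrite (_ : (fun j => Im _) = fun j => if j == i then Im c else 0); last first.
  by apply/funext => j; case: ifP.
by rewrite !rsum_single; case: c.
Qed.

(** Reduces the inner products met below, which are unordered infinite sums, to
    finite ones. *)
Lemma csum_finsupp (s : seq I) (u : I -> R[i]) : uniq s ->
  (forall j, j \notin s -> u j = 0) ->
  csummable u /\ csum u = \sum_(j <- s) u j.
Proof.
elim: s u => [|i s IH] u /=; first move=> _ u0.
  have -> : u = fun=> 0 * 0 by apply/funext => j; rewrite mulr0 u0.
  case: (pselect (exists i : I, True)) => [[i _]|noI].
    have -> : (fun=> 0 * 0) = (fun j => if j == i then 0 else 0 : R[i]).
      by apply/funext => j; rewrite mulr0 if_same.
    by rewrite big_nil csum_single; split=> //; exact: csummable_single.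
  have s0 (v : I -> R) : rsummable v /\ rsum v = 0.
    rewrite /rsum /rsummable /summable !esum1 ?subrr ?ltry//;
      by move=> i _; case: noI; exists i.
  by rewrite big_nil /csum /csummable !(s0 _).2; split=> //; exact: (s0 _).1.
move=> /andP[iNs us] u0.
pose v j := if j == i then 0 else u j.
have [sv cv] : csummable v /\ csum v = \sum_(j <- s) v j.
  apply: IH => // j js; rewrite /v; case: eqP => // /eqP ji.
  by apply: u0; rewrite inE negb_or ji.
have -> : u = fun j => (if j == i then u i else 0) + v j.
  by apply/funext => j; rewrite /v; case: eqP => [->|]; rewrite ?addr0 ?add0r.
split; first by apply: csummableD => //; exact: csummable_single.
rewrite csumD ?csum_single//; last exact: csummable_single.
have vi : v i = 0 by rewrite /v eqxx.
rewrite big_cons eqxx vi addr0 cv; congr (_ + _).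
rewrite !big_seq; apply: eq_bigr => j js; rewrite /v.
case: eqP => [ji|_]; last by rewrite add0r.
by rewrite -ji js in iNs.
Qed.

End finite_sums.

Section H2_basics.
Variables (R : realType) (I : choiceType) (w : I -> {posnum R}).
Local Notation H := (H2space w).
Implicit Types (f g : H) (i j : I).

Definition single_coef i : I -> R[i] := fun j => if j == i then 1 else 0.

Lemma single_coef_subproof i : single_coef i \in sqsummable w.
Proof.
apply/sqsummableP; rewrite /single_coef.
rewrite (_ : (fun j => _) = fun j => if j == i then (w i)%:num ^+ 2 else 0).
  exact: rsummable_single.
apply/funext => j; case: eqP => [->|_]; rewrite ?normc1 ?normc0 ?expr1n ?mul1r//.
by rewrite expr0n mul0r.
Qed.

Definition delta i : H := MkH2 (single_coef_subproof i).

Lemma deltaE i j : coefs (delta i) j = if j == i then 1 else 0.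
Proof. by []. Qed.

Lemma hform_H2E f g : hform H f g =
  csum (fun i => coefs f i * (coefs g i)^* * ((w i)%:num ^+ 2)%:C%C).
Proof. by []. Qed.

Lemma sqr_hnorm_H2 f : (hnorm f ^+ 2)%:E = sqnorm w (coefs f).
Proof.
rewrite sqr_hnorm [hform H f f]H2form_sqnorm /= fineK//.
exact: sqnorm_fin.
Qed.

Lemma coefsD f g i : coefs (f + g) i = coefs f i + coefs g i. Proof. by []. Qed.
Lemma coefsB f g i : coefs (f - g) i = coefs f i - coefs g i. Proof. by []. Qed.
Lemma coefsZ a f i : coefs (a *: f) i = a * coefs f i. Proof. by []. Qed.
Lemma coefs0 i : coefs (0 : H) i = 0. Proof. by []. Qed.

Lemma coefs_sum (J : Type) (r : seq J) (P : pred J) (F : J -> H) i :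
  coefs (\sum_(k <- r | P k) F k) i = \sum_(k <- r | P k) coefs (F k) i.
Proof.
exact: (big_morph (fun f : H => coefs f i) (fun f g => coefsD f g i) (coefs0 i)).
Qed.

Lemma eq_coefs f g : (forall i, coefs f i = coefs g i) -> f = g.
Proof. by move=> fg; apply/val_inj/funext. Qed.

Lemma hform_delta f i : hform H f (delta i) = coefs f i * ((w i)%:num ^+ 2)%:C%C.
Proof.
rewrite hform_H2E -[RHS](csum_single i); congr csum; apply/funext => j.
by rewrite deltaE; case: eqP => [->|_]; rewrite ?conjC1 ?mulr1// conjC0 mulr0 mul0r.
Qed.

Lemma delta_hform f i : hform H (delta i) f = (coefs f i)^* * ((w i)%:num ^+ 2)%:C%C.
Proof. by rewrite hformC hform_delta rmorphM /= conj_real. Qed.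

Lemma sqr_hnorm_delta i : hnorm (delta i) ^+ 2 = (w i)%:num ^+ 2.
Proof. by rewrite sqr_hnorm hform_delta deltaE eqxx mul1r. Qed.

Lemma hnorm_delta i : hnorm (delta i) = (w i)%:num.
Proof.
apply/eqP; rewrite -(eqrXn2 (n := 2)) ?sqr_hnorm_delta ?hnorm_ge0//.
Qed.

Lemma coef_le_hnorm f i : normc (coefs f i) * (w i)%:num <= hnorm f.
Proof.
rewrite -(@ler_pXn2r _ 2)// ?nnegrE ?mulr_ge0 ?normc_ge0 ?hnorm_ge0//.
by rewrite -lee_fin sqr_hnorm_H2 exprMn; exact: le_coef_sqnorm.
Qed.

Lemma H2_bounded_by (K : hilbertSpace R) (x : K) (M : R) f : 0 <= M ->
  (sqnorm w (coefs f) <= (M ^+ 2 * hnorm x ^+ 2)%:E)%E -> hnorm f <= M * hnorm x.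
Proof.
move=> M0; rewrite -sqr_hnorm_H2 lee_fin -exprMn => h.
by rewrite -(@ler_pXn2r _ 2)// ?nnegrE ?mulr_ge0 ?hnorm_ge0.
Qed.

(** Truncating f to a finite set A of indices leaves an error whose squared norm
    is that of f minus the partial sum over A, and the squared norm of f is the
    supremum of the partial sums. *)
Lemma delta_densely_spanning : densely_spanning delta.
Proof.
move=> f e e0.
have [_ [A [finA _] <-]] : exists2 x,
    [set (\sum_(i \in A) (normc (coefs f i) ^+ 2 * (w i)%:num ^+ 2)%:E)%E
      | A in fsets [set: I]] x
    & (sqnorm w (coefs f) - (e ^+ 2)%:E < x)%E.
  apply: ub_ereal_sup_adherent; first by rewrite exprn_gt0.
  exact: (sqnorm_fin f).
rewrite fsbig_finite//= sumEFin -sqr_hnorm_H2 -EFinB lte_fin => hA.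
pose s : seq I := fset_set A; pose l := [seq (coefs f i, i) | i <- s].
exists l; set S := \sum_(i <- _) _ in hA.
have us : uniq s by exact: fset_uniq.
have PE j : coefs (lincomb delta l) j = if j \in s then coefs f j else 0.
  rewrite /lincomb coefs_sum big_map.
  rewrite (eq_bigr (fun i => if i == j then coefs f j else 0)); last first.
    move=> i _; rewrite coefsZ deltaE eq_sym.
    by rewrite /=; case: eqP => [->|]; rewrite ?mulr1 ?mulr0.
  exact: sum_if_eq.
have fP : hform H f (lincomb delta l) = S%:C%C.
  rewrite hform_H2E (csum_finsupp us _).2.
    rewrite /S rmorph_sum /= !big_seq; apply: eq_bigr => j js.
    by rewrite PE js mul_normc_conj -rmorphM.
  by move=> j /negbTE js; rewrite PE js conjC0 mulr0 mul0r.
have PP : hform H (lincomb delta l) (lincomb delta l) = S%:C%C.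
  rewrite hform_H2E (csum_finsupp us _).2.
    rewrite /S rmorph_sum /= !big_seq; apply: eq_bigr => j js.
    by rewrite PE js mul_normc_conj -rmorphM.
  by move=> j /negbTE js; rewrite PE js mul0r mul0r.
have Pf : hform H (lincomb delta l) f = S%:C%C by rewrite hformC fP conj_real.
rewrite -(@ltr_pXn2r _ 2)// ?nnegrE ?hnorm_ge0 ?(ltW e0)//.
rewrite sqr_hnorm hformBl !hformBr PP fP Pf.
by rewrite subrr subr0 hformxx -rmorphB /= ltrBlDr -ltrBlDl.
Qed.

End H2_basics.

Section gram.
Variables (R : realType) (S : Type).
Implicit Types (kappa : S -> S -> R).

(** Real coefficients suffice to state positivity: for a real symmetric kernel,
    the real and imaginary parts of complex coefficients separate
    ([sqr_hnorm_lincomb]). *)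
Definition quad kappa (l : seq (R * S)) : R :=
  \sum_(p <- l) \sum_(q <- l) p.1 * q.1 * kappa p.2 q.2.

Definition psd kappa := forall l, 0 <= quad kappa l.

Definition symmetric_kernel kappa := forall s t, kappa s t = kappa t s.

Definition gram_matrix (H : hilbertSpace R) (phi : S -> H) kappa :=
  forall s t, hform H (phi s) (phi t) = (kappa s t)%:C%C.

Lemma hform_lincombl (H : hilbertSpace R) (phi : S -> H) l x :
  hform H (lincomb phi l) x = \sum_(p <- l) p.1 * hform H (phi p.2) x.
Proof.
rewrite /lincomb.
rewrite (big_morph (fun u : H => hform H u x) (fun u v => hformDl u v x) (hform0l x)).
by apply: eq_bigr => p _; rewrite hformZl.
Qed.

Lemma hform_lincombr (H : hilbertSpace R) (phi : S -> H) l x :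
  hform H x (lincomb phi l) = \sum_(p <- l) (p.1)^* * hform H x (phi p.2).
Proof.
rewrite /lincomb (big_morph (hform H x) (fun u v => hformDr u v x) (hform0r x)).
by apply: eq_bigr => p _; rewrite hformZr.
Qed.

Lemma sqr_hnorm_lincomb (H : hilbertSpace R) (phi : S -> H) kappa l :
  gram_matrix phi kappa ->
  hnorm (lincomb phi l) ^+ 2 =
    quad kappa [seq (Re p.1, p.2) | p <- l] + quad kappa [seq (Im p.1, p.2) | p <- l].
Proof.
move=> gk; rewrite sqr_hnorm hform_lincombl /quad !big_map.
rewrite (big_morph _ (raddfD (@complex.Re R)) (erefl _)) -big_split /=.
apply: eq_bigr => p _; rewrite !big_map hform_lincombr mulr_sumr.
rewrite (big_morph _ (raddfD (@complex.Re R)) (erefl _)) -big_split /=.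
apply: eq_bigr => q _; rewrite gk.
by case: p.1 q.1 => a b [c e] /=; ring.
Qed.

(** This turns an inequality between kernels into the bound required by
    [bounded_extension]. *)
Lemma gram_hnorm_le (H K : hilbertSpace R) (phi : S -> H) (psi : S -> K)
    kappa kappa' l : gram_matrix phi kappa -> gram_matrix psi kappa' ->
  psd (fun s t => kappa s t - kappa' s t) ->
  hnorm (lincomb psi l) <= hnorm (lincomb phi l).
Proof.
move=> gk gk' psdB; rewrite -(@ler_pXn2r _ 2)// ?nnegrE ?hnorm_ge0//.
rewrite (sqr_hnorm_lincomb _ gk) (sqr_hnorm_lincomb _ gk').
have qB m : quad kappa' m <= quad kappa m.
  rewrite -subr_ge0 /quad -sumrB.
  apply: le_trans (psdB m) _; rewrite le_eqVlt; apply/orP; left; apply/eqP.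
  apply: eq_bigr => p _; rewrite -sumrB; apply: eq_bigr => q _.
  by rewrite mulrBr.
exact: lerD.
Qed.

End gram.

(** * Realizing a positive semidefinite kernel by vectors *)

Section spanning.
Variables (R : realType) (H : hilbertSpace R) (S : Type) (phi : S -> H).

Definition spanned x := exists l, x = lincomb phi l.

Lemma spanned0 : spanned 0.
Proof. by exists [::]; rewrite /lincomb big_nil. Qed.

Lemma spanned_vec s : spanned (phi s).
Proof. by exists [:: (1, s)]; rewrite lincomb1. Qed.

Lemma spannedP a x y : spanned x -> spanned y -> spanned (a *: x + y).
Proof.
by move=> [l ->] [m ->]; exists (scale_comb a l ++ m); rewrite lincomb_cat lincombZ.
Qed.

Lemma spanned_lincomb (T : Type) (psi : T -> H) (P : pred T) r :
  (forall t, P t -> spanned (psi t)) -> all P [seq p.2 | p <- r] ->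
  spanned (lincomb psi r).
Proof.
move=> h; elim: r => [|p r IH] /=.
  by rewrite /lincomb big_nil => _; exact: spanned0.
move=> /andP[Pp Pr]; rewrite /lincomb big_cons; apply: spannedP; [exact: h|exact: IH].
Qed.

Lemma densely_spanning_trans (T : Type) (psi : T -> H) :
  (forall t, spanned (psi t)) -> densely_spanning psi -> densely_spanning phi.
Proof.
move=> h dpsi x e e0; have [l hl] := dpsi x e e0.
have [m lm] : spanned (lincomb psi l).
  by apply: (spanned_lincomb (P := predT)) => //; exact: all_predT.
by exists m; rewrite -lm.
Qed.

End spanning.

Section schur_complement.
Variables (R : realType) (S : Type).
Implicit Types kappa : S -> S -> R.

Lemma quad_cons kappa x s l : symmetric_kernel kappa ->
  quad kappa ((x, s) :: l) =
  x ^+ 2 * kappa s s + 2 * x * (\sum_(p <- l) p.1 * kappa p.2 s) + quad kappa l.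
Proof.
move=> sk; rewrite /quad big_cons /= big_cons /= expr2 -!addrA; congr (_ + _).
under [X in _ + X = _]eq_bigr do rewrite big_cons.
rewrite big_split /= addrA; congr (_ + _).
rewrite mulr_sumr -big_split /=; apply: eq_bigr => p _.
by rewrite [kappa s _]sk; ring.
Qed.

Lemma psd_diag_ge0 kappa s : psd kappa -> 0 <= kappa s s.
Proof. by move/(_ [:: (1, s)]); rewrite /quad !big_seq1 !mul1r. Qed.

Lemma psd_diag_eq0 kappa s t : psd kappa -> symmetric_kernel kappa ->
  kappa s s = 0 -> kappa t s = 0.
Proof.
move=> pk sk ks; apply/eqP; apply: contraT => kts.
(* the coefficient of s is chosen to make the quadratic form equal to -1 *)
have := pk [:: (- (kappa t t + 1) / (2 * kappa t s), s); (1, t)].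
rewrite quad_cons// big_seq1 {1}/quad !big_seq1 /= ks mulr0 add0r !mul1r.
rewrite [X in 0 <= X](_ : _ = -1); first by rewrite ler0N1.
by field.
Qed.

(** The Gram matrix of the projections to the orthogonal complement of the
    vector of index s; if that vector is null, division by zero makes it kappa
    itself, which is then correct. *)
Definition schur kappa s : S -> S -> R :=
  fun x y => kappa x y - kappa x s * kappa s y / kappa s s.

Lemma schur_sym kappa s : symmetric_kernel kappa -> symmetric_kernel (schur kappa s).
Proof.
move=> sk x y; rewrite /schur [kappa y x]sk [kappa y s]sk [kappa s x]sk.
by rewrite [_ * kappa x s]mulrC.
Qed.

(** The form of the Schur complement at l is the minimum of the form of kappa
    over the combinations obtained from l by adding a multiple of s. *)
Lemma schur_psd kappa s : symmetric_kernel kappa -> psd kappa -> psd (schur kappa s).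
Proof.
move=> sk pk l; set B := \sum_(p <- l) p.1 * kappa p.2 s.
have -> : quad (schur kappa s) l = quad kappa ((- B / kappa s s, s) :: l).
  rewrite quad_cons// -/B.
  have -> : quad (schur kappa s) l = quad kappa l - B * B / kappa s s.
    rewrite /quad /B mulr_suml mulr_suml -sumrB; apply: eq_bigr => p _.
    rewrite mulr_sumr mulr_suml -sumrB; apply: eq_bigr => q _.
    by rewrite /schur [kappa s _]sk; ring.
  have [->|k0] := eqVneq (kappa s s) 0; first by rewrite invr0; ring.
  by field.
exact: pk.
Qed.

Lemma schur_kills kappa s x : symmetric_kernel kappa -> psd kappa ->
  schur kappa s x s = 0.
Proof.
move=> sk pk; rewrite /schur; have [k0|k0] := eqVneq (kappa s s) 0.
  by rewrite (psd_diag_eq0 x pk sk k0) mul0r mul0r subrr.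
by rewrite mulfK// subrr.
Qed.

Lemma schur_preserves kappa s t : (forall x, kappa x t = 0) ->
  forall x, schur kappa s x t = 0.
Proof. by move=> k0 x; rewrite /schur !k0 mulr0 mul0r subr0. Qed.

End schur_complement.

Section kolmogorov.
Variables (R : realType) (S : countType) (kappa : S -> S -> R).
Hypotheses (ksym : symmetric_kernel kappa) (kpsd : psd kappa).

(** Gram-Schmidt on kernels: the vectors are projected out one after the other,
    in the order of their codes. The sharp inverse of the coding guarantees that
    stage n removes only the index of code n. *)
Fixpoint residual n : S -> S -> R :=
  if n is m.+1 then
    if @pickle_inv S m is Some s then schur (residual m) s else residual m
  else kappa.

Lemma residual_sym_psd n : symmetric_kernel (residual n) /\ psd (residual n).
Proof.
elim: n => [|n [sn pn]] //=; case: pickle_inv => // s.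
by split; [exact: schur_sym | exact: schur_psd].
Qed.

Let rsym n : symmetric_kernel (residual n) := (residual_sym_psd n).1.
Let rpsd n : psd (residual n) := (residual_sym_psd n).2.

Lemma residual_eq0 n s x : (choice.pickle s < n)%N -> residual n x s = 0.
Proof.
elim: n x => // n IH x; rewrite ltnS leq_eqVlt => /predU1P[<-|sn] /=.
  by rewrite pickleK_inv schur_kills.
case: pickle_inv => [t|]; last exact: IH.
by apply: schur_preserves => y; exact: IH.
Qed.

Definition pivot s := residual (choice.pickle s) s s.

Definition pivot_term s x y : R :=
  residual (choice.pickle s) x s * residual (choice.pickle s) s y / pivot s.

Lemma residual_expansion n x y :
  kappa x y = \sum_(m < n) oapp (fun s => pivot_term s x y) 0 (@pickle_inv S m) +
    residual n x y.
Proof.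
elim: n => [|n IH]; first by rewrite big_ord0 add0r.
rewrite big_ord_recr /= {1}IH -addrA; congr (_ + _).
case E: (@pickle_inv S n) => [s|] /=; last by rewrite add0r.
have sn : choice.pickle s = n by have := @pickle_invK S n; rewrite E.
by rewrite /pivot_term /pivot /schur sn addrC subrK.
Qed.

Lemma pivot_ge0 s : 0 <= pivot s. Proof. exact: psd_diag_ge0. Qed.

(** Only the indices with a nonzero pivot contribute a coordinate; dropping the
    others is what makes the vectors [feature s] span a dense subspace. *)
Definition pivots := {s : S | pivot s != 0}.

Lemma pivot_gt0 (j : pivots) : 0 < pivot (val j).
Proof. by rewrite lt0r (valP j) pivot_ge0. Qed.

Definition pivot_weight (j : pivots) : {posnum R} :=
  PosNum (etrans (sqrtr_gt0 _) (pivot_gt0 j)).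

Lemma sqr_pivot_weight j : (pivot_weight j)%:num ^+ 2 = pivot (val j).
Proof. by rewrite sqr_sqrtr// pivot_ge0. Qed.

Definition pivots_below n : seq pivots :=
  pmap insub (pmap (@pickle_inv S) (iota 0 n)).

Lemma mem_pivots_below n j : (j \in pivots_below n) = (choice.pickle (val j) < n)%N.
Proof.
rewrite /pivots_below mem_pmap_sub /= mem_pmap; apply/mapP/idP.
  move=> [m]; rewrite mem_iota /= add0n => mn E.
  by have := @pickle_invK S m; rewrite -E /= => ->.
by move=> jn; exists (choice.pickle (val j)); rewrite ?mem_iota// pickleK_inv.
Qed.

Lemma pivots_below_uniq n : uniq (pivots_below n).
Proof.
apply: pmap_sub_uniq; apply: (pmap_uniq (g := choice.pickle)); last exact: iota_uniq.
exact: pickle_invK.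
Qed.

Lemma sum_pivots_below n (F : S -> R) : (forall s, pivot s = 0 -> F s = 0) ->
  \sum_(j <- pivots_below n) F (val j) =
  \sum_(m < n) oapp F 0 (@pickle_inv S m).
Proof.
move=> F0; rewrite /pivots_below.
rewrite -[RHS](big_mkord xpredT (fun m => oapp F 0 (@pickle_inv S m))).
rewrite /index_iota subn0; elim: (iota 0 n) => [|m r IH]; first by rewrite !big_nil.
rewrite big_cons /=; case: pickle_inv => [s|] /=; last by rewrite add0r.
case: insubP => [j _ <-|/negPn/eqP s0] /=; first by rewrite big_cons IH.
by rewrite F0// add0r IH.
Qed.

(** Row s of the triangular Cholesky factor. The pivots are carried by the
    weight of the sequence space, so the diagonal coefficients are 1. *)
Definition feature_coef s (j : pivots) : R[i] :=
  (residual (choice.pickle (val j)) s (val j) / pivot (val j))%:C%C.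

Lemma feature_coef_eq0 s n j : (choice.pickle s < n)%N -> j \notin pivots_below n ->
  feature_coef s j = 0.
Proof.
move=> sn; rewrite mem_pivots_below -leqNgt => nj.
rewrite /feature_coef rsym residual_eq0 ?mul0r//.
exact: leq_trans nj.
Qed.

Lemma feature_subproof s : feature_coef s \in sqsummable pivot_weight.
Proof.
apply/sqsummableP.
pose u (j : pivots) : R[i] :=
  (normc (feature_coef s j) ^+ 2 * (pivot_weight j)%:num ^+ 2)%:C%C.
have u0 j : j \notin pivots_below (choice.pickle s).+1 -> u j = 0.
  by move=> js; rewrite /u (feature_coef_eq0 (leqnn _) js) normc0 expr0n mul0r.
exact: csummable_Re (csum_finsupp (pivots_below_uniq _) u0).1.
Qed.

Definition feature s : H2space pivot_weight := MkH2 (feature_subproof s).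

Lemma featureE s j : coefs (feature s) j = feature_coef s j. Proof. by []. Qed.

Lemma feature_gram : gram_matrix feature kappa.
Proof.
move=> s t; set n := (maxn (choice.pickle s) (choice.pickle t)).+1.
rewrite hform_H2E (csum_finsupp (pivots_below_uniq n) _).2; last first.
  move=> j jn; rewrite featureE (feature_coef_eq0 _ jn) ?mul0r//.
  by rewrite ltnS leq_maxl.
rewrite (residual_expansion n) (@residual_eq0 n t) ?ltnS ?leq_maxr// addr0.
rewrite -sum_pivots_below; last by move=> r r0; rewrite /pivot_term r0 invr0 mulr0.
rewrite rmorph_sum; apply: eq_bigr => j _.
rewrite !featureE conj_real -!rmorphM /= sqr_pivot_weight /pivot_term.
rewrite [residual _ t _]rsym; congr (_%:C%C); field.
exact: (valP j).
Qed.

(** By triangularity, the unit vector of a pivot j is [feature (val j)] minus a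
    combination of unit vectors of earlier pivots. *)
Lemma feature_densely_spanning : densely_spanning feature.
Proof.
apply: densely_spanning_trans (@delta_densely_spanning _ _ _) => j.
have [n] := ubnP (choice.pickle (val j)); elim: n j => // n IH j; rewrite ltnS => jn.
set l : seq (R[i] * pivots) :=
  [seq (- feature_coef (val j) i, i) | i <- pivots_below (choice.pickle (val j))].
have -> : delta pivot_weight j = 1 *: lincomb (@delta _ _ _) l + feature (val j).
  apply: eq_coefs => i; rewrite scale1r coefsD deltaE featureE.
  rewrite /lincomb coefs_sum big_map.
  rewrite (eq_bigr (fun k => if k == i then - feature_coef (val j) i else 0)); last first.
    move=> k _; rewrite coefsZ deltaE /= eq_sym.
    by case: eqP => [->|]; rewrite ?mulr1 ?mulr0.
  rewrite sum_if_eq ?pivots_below_uniq//; case: (boolP (i \in pivots_below _)) => ij.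
    rewrite addNr.
    by case: eqP => // eij; rewrite mem_pivots_below eij ltnn in ij.
  rewrite add0r.
  case: eqP => [->|/eqP nij].
    rewrite /feature_coef -/(pivot _) divff ?(valP j)//.
  rewrite (@feature_coef_eq0 _ (choice.pickle (val j)).+1)//.
  rewrite mem_pivots_below ltnS leq_eqVlt negb_or -mem_pivots_below ij andbT.
  by apply: contra nij => /eqP/(pcan_inj choice.pickleK)/val_inj ->.
apply: spannedP; last exact: spanned_vec.
apply: (spanned_lincomb (P := mem (pivots_below (choice.pickle (val j))))).
  by move=> i ib; apply: IH; rewrite (leq_trans _ jn)// -mem_pivots_below.
by apply/allP => i /mapP[p /mapP[k kb ->] ->].
Qed.

(** Kolmogorov's theorem; countability of S is what puts the vectors in the order
    that the Cholesky factorization follows. *)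
Theorem kernel_realization : exists (K : hilbertSpace R) (phi : S -> K),
  gram_matrix phi kappa /\ densely_spanning phi.
Proof.
by exists (H2space pivot_weight), feature; split;
  [exact: feature_gram | exact: feature_densely_spanning].
Qed.

End kolmogorov.

(** * Positive semidefinite kernels on multi-indices *)

Section psd_closure.
Variables (R : realType) (S : Type).
Implicit Types kappa : S -> S -> R.

Lemma eq_psd kappa kappa' : (forall s t, kappa s t = kappa' s t) ->
  psd kappa -> psd kappa'.
Proof.
move=> e pk l; rewrite (_ : quad _ _ = quad kappa l)//.
by apply: eq_bigr => p _; apply: eq_bigr => q _; rewrite e.
Qed.

Lemma quadD kappa kappa' l :
  quad (fun s t => kappa s t + kappa' s t) l = quad kappa l + quad kappa' l.
Proof.
rewrite /quad -big_split; apply: eq_bigr => p _ /=.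
by rewrite -big_split; apply: eq_bigr => q _ /=; rewrite mulrDr.
Qed.

Lemma quadZ (c : R) kappa l : quad (fun s t => c * kappa s t) l = c * quad kappa l.
Proof.
rewrite /quad mulr_sumr; apply: eq_bigr => p _.
by rewrite mulr_sumr; apply: eq_bigr => q _; rewrite mulrCA.
Qed.

Lemma psd0 : psd (fun _ _ : S => 0 : R).
Proof.
by move=> l; rewrite /quad big1// => p _; rewrite big1// => q _; rewrite mulr0.
Qed.

Lemma psdD kappa kappa' : psd kappa -> psd kappa' ->
  psd (fun s t => kappa s t + kappa' s t).
Proof. by move=> pk pk' l; rewrite quadD addr_ge0. Qed.

Lemma psdZ (c : R) kappa : 0 <= c -> psd kappa -> psd (fun s t => c * kappa s t).
Proof. by move=> c0 pk l; rewrite quadZ mulr_ge0. Qed.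

Lemma psd_sum (I : Type) (r : seq I) (P : pred I) (kappa_ : I -> S -> S -> R) :
  (forall i, P i -> psd (kappa_ i)) ->
  psd (fun s t => \sum_(i <- r | P i) kappa_ i s t).
Proof.
move=> pk; elim: r => [|i r IH].
  by apply: eq_psd psd0 => s t; rewrite big_nil.
case: (boolP (P i)) => Pi.
  by apply: eq_psd (psdD (pk i Pi) IH) => s t; rewrite big_cons Pi.
by apply: eq_psd IH => s t; rewrite big_cons (negbTE Pi).
Qed.

Lemma psd_cvg (u : nat -> S -> S -> R) kappa : (forall n, psd (u n)) ->
  (forall s t, u n s t @[n --> \oo] --> kappa s t) -> psd kappa.
Proof.
move=> pu cu l.
have cq : quad (u n) l @[n --> \oo] --> quad kappa l.
  apply: cvg_big => //; first by move=> ? ?; exact: add_continuous.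
  move=> p _; apply: cvg_big => //; first by move=> ? ?; exact: add_continuous.
  by move=> q _; apply: cvgMr.
apply: (cvgr_to_ge cq); apply: nearW => n; exact: pu.
Qed.

(** This replaces the coefficients c_s by x_s c_s. *)
Lemma psd_rescale (x : S -> R) kappa : psd kappa ->
  psd (fun s t => x s * x t * kappa s t).
Proof.
move=> pk l; have := pk [seq (p.1 * x p.2, p.2) | p <- l].
rewrite /quad big_map /=; congr (0 <= _); apply: eq_bigr => p _.
by rewrite big_map; apply: eq_bigr => q _ /=; ring.
Qed.

End psd_closure.

(** The form is the sum over the classes of the squares of the sums of the
    coefficients in each class. *)
Lemma psd_same_class (R : realType) (S T : eqType) (cls : S -> T) :
  psd (fun s t => (cls s == cls t)%:R : R).
Proof.
move=> l; pose V := undup [seq cls p.2 | p <- l].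
rewrite (_ : quad _ _ =
    \sum_(v <- V) (\sum_(p <- l) p.1 * (cls p.2 == v)%:R) ^+ 2).
  by apply: sumr_ge0 => v _; exact: sqr_ge0.
transitivity (\sum_(p <- l) \sum_(v <- V)
    (p.1 * (cls p.2 == v)%:R) * (\sum_(q <- l) q.1 * (cls q.2 == v)%:R)); last first.
  by rewrite exchange_big; apply: eq_bigr => v _ /=; rewrite -mulr_suml expr2.
rewrite /quad big_seq [in RHS]big_seq; apply: eq_bigr => p pl.
have pV : cls p.2 \in V by rewrite mem_undup map_f.
transitivity (\sum_(v <- V) if v == cls p.2
    then \sum_(q <- l) p.1 * q.1 * (cls p.2 == cls q.2)%:R else 0).
  by rewrite sum_if_eq ?undup_uniq// pV.
apply: eq_bigr => v _; rewrite eq_sym; case: eqP => [<-|]; last by rewrite mulr0 mul0r.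
by rewrite mulr1 mulr_sumr; apply: eq_bigr => q _; rewrite mulrA [cls q.2 == _]eq_sym.
Qed.

Section multi_index_arith.
Variable d : nat.
Implicit Types (a b : mindex d) (i : 'I_d).

Definition madd a b : mindex d := [ffun i => (a i + b i)%N].

Definition mshift i a : mindex d := [ffun j => (a j + (j == i))%N].

Definition munshift i a : mindex d := [ffun j => (a j - (j == i))%N].

Lemma mshiftK i : cancel (mshift i) (munshift i).
Proof. by move=> a; apply/ffunP => j; rewrite !ffunE addnK. Qed.

Lemma munshiftK i a : (0 < a i)%N -> mshift i (munshift i a) = a.
Proof.
move=> ai; apply/ffunP => j; rewrite !ffunE.
by case: eqP => [->|_]; rewrite ?subnK ?subn0 ?addn0.
Qed.

Lemma mshift_gt0 i a : (0 < mshift i a i)%N.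
Proof. by rewrite ffunE eqxx addn1. Qed.

Lemma mshift_inj i : injective (mshift i). Proof. exact: can_inj (mshiftK i). Qed.

Lemma mshiftC i j a : mshift i (mshift j a) = mshift j (mshift i a).
Proof. by apply/ffunP => k; rewrite !ffunE addnAC. Qed.

Lemma madd_shiftl i a b : madd (mshift i a) b = mshift i (madd a b).
Proof. by apply/ffunP => j; rewrite !ffunE addnAC. Qed.

Lemma madd_shiftr i a b : madd a (mshift i b) = mshift i (madd a b).
Proof. by apply/ffunP => j; rewrite !ffunE addnA. Qed.

Lemma mdegree_shift i a : mdegree (mshift i a) = (mdegree a).+1.
Proof.
rewrite /mdegree (eq_bigr (fun j => a j + (j == i))%N); last by move=> j _; rewrite ffunE.
rewrite big_split /= -(addn1 (\sum_i a i)); congr addn.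
by rewrite (bigD1 i)//= eqxx big1// => j /negbTE ->.
Qed.

(** For a pair (a, b), the weight a - b under which the torus acts on
    z^a conj(z)^b; functions of different weight are orthogonal for any
    torus-invariant measure. *)
Definition balance (s : mindex d * mindex d) : {ffun 'I_d -> int} :=
  [ffun i => (s.1 i)%:Z - (s.2 i)%:Z].

Lemma balanceP (s t : mindex d * mindex d) :
  (balance s == balance t) = (madd s.1 t.2 == madd t.1 s.2).
Proof.
apply/eqP/eqP => /ffunP h; apply/ffunP => i; have := h i; rewrite !ffunE.
  by lia.
by lia.
Qed.

Lemma balance_add (s t : mindex d * mindex d) : balance s = balance t ->
  forall i, ((s.1 i + s.2 i) + (t.1 i + t.2 i) = 2 * madd s.1 t.2 i)%N.
Proof. by move=> /ffunP h i; have := h i; rewrite !ffunE; lia. Qed.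

Lemma balance_mdegree (s t : mindex d * mindex d) : balance s = balance t ->
  (mdegree (madd s.1 s.2) + mdegree (madd t.1 t.2) = 2 * mdegree (madd s.1 t.2))%N.
Proof.
move=> /balance_add h; rewrite /mdegree -big_split big_distrr; apply: eq_bigr => i _ /=.
by rewrite -h !ffunE.
Qed.

End multi_index_arith.

Section moment_kernels.
Variables (R : realType) (d : nat).
Local Notation S := (mindex d * mindex d)%type.

(** The inner products of the functions z^a conj(z)^b for a torus-invariant
    measure in which the monomials z^a have squared norms w a: for pairs of equal
    weight, z^a conj(z)^b times the conjugate of z^a' conj(z)^b' is
    |z^(a + b')|^2. *)
Definition mixed_kernel (w : mindex d -> R) (s t : S) : R :=
  (balance s == balance t)%:R * w (madd s.1 t.2).

Lemma mixed_kernel_sym w : symmetric_kernel (mixed_kernel w).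
Proof.
move=> s t; rewrite /mixed_kernel eq_sym; case: (eqVneq (balance t)) => [e|_].
  by rewrite (eqP (etrans (esym (balanceP t s)) (introT eqP e))).
by rewrite !mul0r.
Qed.

(** For pairs of equal balance the degree of a + b' is half that of
    (a + b) + (a' + b'), so the power of tau is a product of a function of (a, b)
    and the same function of (a', b'): a rescaling. *)
Lemma psd_mixed_kernel_pow w (tau : R) : 0 <= tau -> psd (mixed_kernel w) ->
  psd (mixed_kernel (fun a => w a * tau ^+ mdegree a)).
Proof.
move=> tau0 pw; pose x (s : S) := Num.sqrt tau ^+ mdegree (madd s.1 s.2).
apply: eq_psd (psd_rescale x pw) => s t; rewrite /mixed_kernel.
case: (eqVneq (balance s)) => [e|_]; last by rewrite !mul0r mulr0.
rewrite !mul1r mulrC; congr (_ * _).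
by rewrite /x -exprD (balance_mdegree e) exprM sqr_sqrtr.
Qed.

(** By [hausdorff_moment_cvg] the kernel is a pointwise limit of nonnegative
    combinations of the kernels of [psd_mixed_kernel_pow]. *)
Lemma psd_mixed_kernel_monotone w (g : nat -> R) : completely_monotone g ->
  psd (mixed_kernel w) -> psd (mixed_kernel (fun a => w a * g (mdegree a))).
Proof.
move=> cg pw; pose u n (s t : S) := \sum_(j < n.+1) bernstein_weight g n j *
  mixed_kernel (fun a => w a * (j%:R / n%:R) ^+ mdegree a) s t.
apply: (@psd_cvg _ _ u).
  move=> n; apply: psd_sum => j _; apply: psdZ; first exact: bernstein_weight_ge0.
  by apply: psd_mixed_kernel_pow => //; rewrite divr_ge0.
move=> s t; rewrite /u /mixed_kernel.
rewrite (_ : (fun n => _) = fun n => (balance s == balance t)%:R * w (madd s.1 t.2) *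
    \sum_(j < n.+1) bernstein_weight g n j * (j%:R / n%:R) ^+ mdegree (madd s.1 t.2)).
  by rewrite mulrA; apply: cvgMr; exact: hausdorff_moment_cvg.
apply/funext => n; rewrite mulr_sumr; apply: eq_bigr => j _; ring.
Qed.

End moment_kernels.

(** * Moments of the measure *)

Section moments.
Variables (R : realType) (d : nat).
Local Notation Cd := (Cd R d).
Local Notation borel_Cd := (borel_Cd R d).

Lemma normc_ler_dist (x y : R[i]) : `|normc x - normc y| <= normc (x - y).
Proof.
have h (u v : R[i]) : normc u - normc v <= normc (u - v).
  by rewrite lerBlDr -{1}(subrK v u); exact: le_normcD.
rewrite ler_norml h andbT lerNl opprB.
by rewrite -[normc (x - y)]normcN opprB.
Qed.

Lemma modulus_continuous i : continuous (fun z : Cd => normc (z 0 i : R[i])).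
Proof.
move=> z; have FF : Filter (nbhs (z : 'rV[R[i]^o]_d)) by exact: nbhs_filter.
apply/(@cvgrPdist_lt _ _ _ _ FF) => e e0.
have ce0 : 0 < e%:C%C :> R[i] by rewrite ltcR.
have /(@cvgrPdist_lt _ _ _ _ FF) /(_ _ ce0) := @coord_continuous R[i] 1 d 0 i z.
apply: filterS => t; rewrite -Defs.normcE ltcR.
exact: le_lt_trans (normc_ler_dist _ _).
Qed.

Lemma measurable_modulus i :
  measurable_fun setT (fun z : borel_Cd => normc ((z : Cd) 0 i : R[i])).
Proof.
apply: (measurability _ (RGenOpens.measurableE R)) => //.
move=> _ [_ [a [b ->]] <-]; rewrite setTI; apply: sub_sigma_algebra.
by move/continuousP: (@modulus_continuous i); apply; exact: interval_open.
Qed.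

Definition sqmon (a : mindex d) (z : Cd) : R := normc (monomial z a) ^+ 2.

Lemma normc_monomial z a :
  normc (monomial z a) = \prod_(i < d) normc (z 0 i : R[i]) ^+ a i.
Proof.
rewrite /monomial.
rewrite (big_morph (@normc R) (@normcM R) (@normc1 R)).
apply: eq_bigr => i _.
by elim: (a i) => [|k IH]; rewrite ?expr0 ?normc1// !exprS normcM IH.
Qed.

Lemma measurable_normc_monomial a :
  measurable_fun setT (fun z : borel_Cd => normc (monomial z a)).
Proof.
rewrite (_ : (fun z => _) = fun z : borel_Cd =>
    \prod_(i < d) normc ((z : Cd) 0 i : R[i]) ^+ a i).
  by apply: measurable_prod => i _; apply: measurable_funX; exact: measurable_modulus.
by apply/funext => z; rewrite normc_monomial.
Qed.

Lemma measurable_sqmon a : measurable_fun setT (sqmon a : borel_Cd -> R).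
Proof. by apply: measurable_funX; exact: measurable_normc_monomial. Qed.

Lemma sqmon_shift i a z : sqmon (mshift i a) z = normc (z 0 i : R[i]) ^+ 2 * sqmon a z.
Proof.
rewrite /sqmon !normc_monomial -exprMn; congr (_ ^+ 2).
rewrite (eq_bigr (fun j => (if j == i then normc (z 0 i : R[i]) else 1) *
    normc (z 0 j : R[i]) ^+ a j)); last first.
  move=> j _; rewrite ffunE exprD mulrC.
  by case: eqP => [->|_]; rewrite ?expr1 ?expr0.
by rewrite big_split /= -big_mkcond big_pred1_eq.
Qed.

Lemma sqmon_sum a z : sphere_Cd z -> \sum_i sqmon (mshift i a) z = sqmon a z.
Proof.
move=> Sz; under eq_bigr do rewrite sqmon_shift.
by rewrite -mulr_suml [X in X * _]Sz mul1r.
Qed.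

(** Equal balance means 2 (a + b') = (a + b) + (a' + b'), so |z^(a + b')|^2 is a
    function of (a, b) times the same function of (a', b'). *)
Lemma sqmon_balance (s t : mindex d * mindex d) z : balance s = balance t ->
  sqmon (madd s.1 t.2) z =
    normc (monomial z (madd s.1 s.2)) * normc (monomial z (madd t.1 t.2)).
Proof.
move=> e; rewrite /sqmon !normc_monomial -prodrXl -big_split; apply: eq_bigr => i _ /=.
by rewrite -exprM -exprD mulnC -(balance_add e) !ffunE.
Qed.

Section fixed_measure.
Variables (nu : {finite_measure set borel_Cd -> \bar R}) (m : mindex d -> R).
Hypothesis nu_sphere : nu (~` @sphere_Cd R d) = 0%E.
Hypothesis mE : forall a, (\int[nu]_z (sqmon a z)%:E = (m a)%:E)%E.

Lemma sqmon_integrable a : nu.-integrable setT (EFin \o (sqmon a : borel_Cd -> R)).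
Proof.
apply/integrableP; split.
  by apply/measurable_EFinP; exact: measurable_sqmon.
rewrite (eq_integral (fun z : borel_Cd => (sqmon a z)%:E)) ?mE ?ltry// => z _ /=.
by rewrite ger0_norm// sqr_ge0.
Qed.

(** The measure lives on the sphere, where the |z_i|^2 sum to 1. *)
Lemma moment_sum a : \sum_i m (mshift i a) = m a.
Proof.
apply: EFin_inj; rewrite -sumEFin -mE.
rewrite (eq_bigr (fun i => (\int[nu]_z (sqmon (mshift i a) z)%:E)%E)); last first.
  by move=> i _; rewrite mE.
rewrite -ge0_integral_sum//; last 2 first.
- by move=> i; apply/measurable_EFinP; exact: measurable_sqmon.
- by move=> i z _; rewrite lee_fin sqr_ge0.
have mS : measurable (~` @sphere_Cd R d : set borel_Cd).
  apply: measurableC.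
  rewrite (_ : @sphere_Cd R d = (fun z : borel_Cd =>
    \sum_(i < d) normc ((z : Cd) 0 i : R[i]) ^+ 2) @^-1` [set 1])//.
  rewrite -[X in measurable X]setTI; apply: (_ : measurable_fun _ _) => //.
  by apply: measurable_sum => i; apply: measurable_funX; exact: measurable_modulus.
rewrite (ge0_negligible_integral mS)//; last 2 first.
- apply: emeasurable_sum => i; apply/measurable_EFinP; exact: measurable_sqmon.
- by move=> z _; apply: sume_ge0 => i _; rewrite lee_fin sqr_ge0.
rewrite [RHS](ge0_negligible_integral mS)//; last 2 first.
- by apply/measurable_EFinP; exact: measurable_sqmon.
- by move=> z _; rewrite lee_fin sqr_ge0.
apply: eq_integral => z; rewrite inE => -[_ /contrapT Sz].
by rewrite sumEFin sqmon_sum.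
Qed.

Lemma integral_sqmon_lincomb (J : Type) (r : seq J) (c : J -> R) (a : J -> mindex d) :
  (\int[nu]_z (\sum_(j <- r) c j * sqmon (a j) z)%:E =
    (\sum_(j <- r) c j * m (a j))%:E)%E.
Proof.
transitivity (\int[nu]_z (\sum_(j <- r) (c j)%:E * (sqmon (a j) z)%:E))%E.
  by apply: eq_integral => z _; rewrite -sumEFin.
rewrite integral_sum//; last first.
  by move=> j; apply: integrableZl => //; exact: sqmon_integrable.
rewrite -sumEFin; apply: eq_bigr => j _.
by rewrite integralZl ?mE ?EFinM//; exact: sqmon_integrable.
Qed.

(** The form is an integral over z of forms that are nonnegative for each z: by
    [sqmon_balance] the integrand is a rescaled kernel of equality of
    balances. *)
Lemma moment_psd : psd (mixed_kernel m).
Proof.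
move=> l; pose J := [seq (p, q) | p <- l, q <- l].
have -> : quad (mixed_kernel m) l = \sum_(j <- J)
    (j.1.1 * j.2.1 * (balance j.1.2 == balance j.2.2)%:R) * m (madd j.1.2.1 j.2.2.2).
  rewrite big_allpairs /quad; apply: eq_bigr => p _; apply: eq_bigr => q _ /=.
  by rewrite /mixed_kernel; ring.
rewrite -lee_fin -(integral_sqmon_lincomb J (fun j => j.1.1 * j.2.1 * _)).
apply: integral_ge0 => z _; rewrite lee_fin big_allpairs.
have := psd_rescale (fun s : mindex d * mindex d => normc (monomial z (madd s.1 s.2)))
  (@psd_same_class R _ _ (@balance d)) l.
rewrite /quad; congr (0 <= _); apply: eq_bigr => p _; apply: eq_bigr => q _ /=.
case: (eqVneq (balance p.2)) => [e|_]; last by rewrite !mulr0 mul0r.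
by rewrite !mulr1 (sqmon_balance _ e).
Qed.

End fixed_measure.

Lemma slice_moment (nu : {finite_measure set borel_Cd -> \bar R})
    (beta : mindex d -> {posnum R}) (gamma : nat -> {posnum R}) a :
  slice_representation beta nu gamma ->
  (\int[nu]_z (sqmon a z)%:E =
    (((beta a)%:num / (gamma (mdegree a))%:num) ^+ 2)%:E)%E.
Proof.
move=> [_ /(_ a)]; set N := Lnorm _ _ _ => bE.
have NE : N = ((beta a)%:num / (gamma (mdegree a))%:num)%:E.
  have g0 : (gamma (mdegree a))%:num != 0 by [].
  rewrite mulrC EFinM bE muleA -EFinM mulVf// mul1e//.
transitivity (\int[nu]_z
    (`|(EFin \o (fun z : borel_Cd => normc (monomial z a))) z| `^ 2))%E.
  apply: eq_integral => z _ /=.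
  rewrite ger0_norm ?normc_ge0// /sqmon /= powR_mulrn ?normc_ge0//.
rewrite -poweR_Lnorm// -/N NE /= powR_mulrn// divr_ge0//.
Qed.

End moments.

(** * Weighted shifts and their adjoints *)

Section dense_identities.
Variables (R : realType) (H K : hilbertSpace R) (S : Type) (phi : S -> H).
Hypothesis dphi : densely_spanning phi.

Lemma dense_adjoint (X Y : H -> H) : bounded_op X -> bounded_op Y ->
  (forall s t, hform H (X (phi s)) (phi t) = hform H (phi s) (Y (phi t))) ->
  forall x y, hform H (X x) y = hform H x (Y y).
Proof.
move=> bX bY XY x y; apply/eqP; rewrite -subr_eq0; apply/eqP.
have [Xl _ [M M0 XM]] := bounded_linearP bX.
have [Yl _ [L L0 YL]] := bounded_linearP bY.
apply: (dense_sesquilinear_eq0 dphi dphi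
    (f := fun x y => hform H (X x) y - hform H x (Y y)) (M := M + L)).
- by move=> a u v z; rewrite Xl !hformDl !hformZl; ring.
- by move=> a u v z; rewrite Yl !hformDr !hformZr; ring.
- move=> u v; apply: (le_trans (le_normcD _ _)); rewrite normcN -mulrA mulrDl.
  apply: lerD; apply: (le_trans (cauchy_schwarz _ _)).
    by rewrite mulrA ler_wpM2r ?hnorm_ge0.
  by rewrite mulrCA ler_wpM2l ?hnorm_ge0.
- by move=> s t; rewrite XY subrr.
Qed.

Lemma dense_isometry (V : H -> K) : bounded_linear V ->
  (forall s t, hform K (V (phi s)) (V (phi t)) = hform H (phi s) (phi t)) ->
  forall x y, hform K (V x) (V y) = hform H x y.
Proof.
move=> bV VV x y; apply/eqP; rewrite -subr_eq0; apply/eqP.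
have [Vl _ [M M0 VM]] := bounded_linearP bV.
apply: (dense_sesquilinear_eq0 dphi dphi
    (f := fun x y => hform K (V x) (V y) - hform H x y) (M := M * M + 1)).
- by move=> a u v z; rewrite Vl !hformDl !hformZl; ring.
- by move=> a u v z; rewrite Vl !hformDr !hformZr; ring.
- move=> u v; apply: (le_trans (le_normcD _ _)); rewrite normcN -mulrA mulrDl mul1r.
  apply: lerD; apply: (le_trans (cauchy_schwarz _ _)) => //.
  by rewrite mulrACA ler_pM ?hnorm_ge0.
- by move=> s t; rewrite VV subrr.
Qed.

Lemma dense_eq (X Y : H -> K) : bounded_linear X -> bounded_linear Y ->
  (forall s, X (phi s) = Y (phi s)) -> forall x, X x = Y x.
Proof.
move=> bX bY XY x; apply/eq_hform => z; apply/eqP; rewrite -subr_eq0; apply/eqP.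
have [Xl _ [M M0 XM]] := bounded_linearP bX.
have [Yl _ [L L0 YL]] := bounded_linearP bY.
apply: (dense_functional_eq0 dphi
    (f := fun x => hform K (X x) z - hform K (Y x) z) (M := (M + L) * hnorm z)).
- by move=> a u v; rewrite Xl Yl !hformDl !hformZl; ring.
- move=> u; apply: (le_trans (le_normcD _ _)); rewrite normcN mulrAC !mulrDl.
  by apply: lerD; apply: (le_trans (cauchy_schwarz _ _)); rewrite ler_wpM2r ?hnorm_ge0.
- by move=> s; rewrite XY subrr.
Qed.

End dense_identities.

Lemma bounded_linear_comp (R : realType) (H K L : hilbertSpace R)
    (X : K -> L) (Y : H -> K) :
  bounded_linear X -> bounded_linear Y -> bounded_linear (X \o Y).
Proof.
move=> bX bY; have [Xl _ [M M0 XM]] := bounded_linearP bX.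
have [Yl _ [N N0 YN]] := bounded_linearP bY.
split; first by move=> a x y /=; rewrite Yl Xl.
exists (M * N) => x; apply: (le_trans (XM _)).
by rewrite -mulrA ler_wpM2l.
Qed.

Section diagonal_operators.
Variables (R : realType) (I : choiceType) (w : I -> {posnum R}).
Local Notation H := (H2space w).

(** Covers diagonal operators, with s the identity, and the adjoints of weighted
    shifts, with s the forward shift of indices. *)
Lemma weighted_composition (s : I -> I) (c : I -> R) (M : R) : injective s ->
  0 <= M -> (forall i, `|c i| * (w i)%:num <= M * (w (s i))%:num) ->
  exists X : H -> H, bounded_op X /\
    forall f i, coefs (X f) i = (c i)%:C%C * coefs f (s i).
Proof.
move=> sI M0 cM.
have le f : (sqnorm w (fun i => ((c i)%:C%C * coefs (f : H) (s i))%R) <=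
    (M ^+ 2 * hnorm f ^+ 2)%:E)%E.
  rewrite EFinM sqr_hnorm_H2 /sqnorm -esumZ ?sqr_ge0//; last first.
    by move=> i; rewrite !(sqr_ge0, mulr_ge0).
  pose F i := (M ^+ 2 * (normc (coefs f i) ^+ 2 * (w i)%:num ^+ 2))%:E.
  have F0 i : (0 <= F i)%E by rewrite lee_fin !(sqr_ge0, mulr_ge0).
  apply: (@le_trans _ _ (\esum_(i in [set: I]) F (s i))%E).
    apply: le_esum => i _; rewrite lee_fin normcM normc_real exprMn.
    rewrite [leLHS](_ : _ = normc (coefs f (s i)) ^+ 2 * (`|c i| * (w i)%:num) ^+ 2);
      last by ring.
    rewrite [leRHS](_ : _ = normc (coefs f (s i)) ^+ 2 * (M * (w (s i))%:num) ^+ 2);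
      last by ring.
    by rewrite ler_wpM2l ?sqr_ge0// lerXn2r ?nnegrE ?mulr_ge0.
  have sbij : set_bij setT (range s) s.
    by split=> [i _|i j _ _|i [j _ <-]]; [exists i|exact: sI|exists j].
  rewrite -(@reindex_esum _ _ _ _ _ _ F sbij) esum_mkcond.
  by apply: le_esum => i _; case: ifP => // _; exact: F0.
have mem f : (fun i => (c i)%:C%C * coefs (f : H) (s i)) \in sqsummable w.
  by apply/asboolP; apply: le_lt_trans (le f) _; rewrite ltry.
exists (fun f => MkH2 (mem f)); split=> //; split.
  by move=> a f g; apply: eq_coefs => i /=; rewrite mulrDr mulrCA.
by exists M => f; apply: H2_bounded_by => //; exact: le.
Qed.

Lemma diagonal_form_ge0 (f h : H) (y : I -> R) : (forall i, 0 <= y i) ->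
  (forall i, coefs h i = (y i)%:C%C * coefs f i) -> 0 <= hform H h f.
Proof.
move=> y0 hf.
have E : (fun i => coefs h i * (coefs f i)^* * ((w i)%:num ^+ 2)%:C%C) =
    (fun i => (y i * normc (coefs f i) ^+ 2 * (w i)%:num ^+ 2)%:C%C).
  apply/funext => i; rewrite hf -mulrA -mulrA [_^* * _]mulrC [coefs f i * _]mulrCA.
  by rewrite mul_normc_conj -!rmorphM /=; congr (_%:C%C); ring.
have := H2form_summable h f; rewrite E => /csummable_Re /= sm.
rewrite hform_H2E E csum_real lecR.
rewrite rsum_ge0//; last by move=> i; rewrite !(sqr_ge0, mulr_ge0).
by apply/fine_ge0/esum_ge0 => i _; rewrite lee_fin !(sqr_ge0, mulr_ge0).
Qed.

End diagonal_operators.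

Section weighted_shifts.
Variables (R : realType) (d : nat) (beta : mindex d -> {posnum R}).
Local Notation H := (H2space beta).
Local Notation w2 a := ((beta a)%:num ^+ 2).

Definition is_weighted_shift (i : 'I_d) (x : mindex d -> R) (T : H -> H) :=
  forall f, coefs (T f) = coord_mul i (fun a => (x a)%:C%C * coefs f a).

Lemma coord_mul_shift i (f : mindex d -> R[i]) a : coord_mul i f (mshift i a) = f a.
Proof. by rewrite /coord_mul mshift_gt0; congr f; exact: mshiftK. Qed.

Lemma coord_mul_delta i (x : mindex d -> R) a b :
  coord_mul i (fun c => (x c)%:C%C * coefs (delta beta a) c) b =
  if b == mshift i a then (x a)%:C%C else 0.
Proof.
rewrite /coord_mul; case: ifPn => bi; last first.
  by case: eqP => // ba; rewrite ba mshift_gt0 in bi.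
rewrite deltaE -/(munshift i b).
have -> : (munshift i b == a) = (b == mshift i a).
  by apply/eqP/eqP => [<-|->]; rewrite ?munshiftK ?mshiftK.
by case: eqP => [->|_]; rewrite ?mshiftK ?mulr1 ?mulr0.
Qed.

Lemma coord_mul_delta1 i a :
  coord_mul i (coefs (delta beta a)) = coefs (delta beta (mshift i a)).
Proof.
apply/funext => b; rewrite deltaE -(coord_mul_delta i (fun=> 1)).
by congr (coord_mul i _ b); apply/funext => c; rewrite mul1r.
Qed.

(** The candidate adjoint is a bounded backward weighted shift; the bound on its
    weights comes from the norms of the images under T of the unit vectors. *)
Lemma weighted_shift_adjoint i x T : bounded_op T -> is_weighted_shift i x T ->
  forall g a, coefs (adjoint T g) a =
    (x a * w2 (mshift i a) / w2 a)%:C%C * coefs g (mshift i a).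
Proof.
move=> bT Tx; have [Tl _ [M M0 TM]] := bounded_linearP bT.
have Td a : coefs (T (delta beta a)) = fun b => if b == mshift i a then (x a)%:C%C else 0.
  by rewrite Tx; apply/funext => b; rewrite coord_mul_delta.
have [] := @weighted_composition R _ beta (mshift i)
    (fun a => x a * w2 (mshift i a) / w2 a) M (@mshift_inj d i) M0.
  move=> a; rewrite -[x a * _ / _]mulrA normrM [ `|_ / _| ]ger0_norm; last first.
    by rewrite divr_ge0 ?sqr_ge0.
  have := le_trans (coef_le_hnorm (T (delta beta a)) (mshift i a)) (TM _).
  rewrite Td eqxx normc_real hnorm_delta => h.
  have b0 : (beta a)%:num != 0 by [].
  rewrite [leLHS](_ : _ = `|x a| * (beta (mshift i a))%:num *
      ((beta (mshift i a))%:num / (beta a)%:num)); last by field.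
  apply: (le_trans (ler_wpM2r _ h)); first by rewrite divr_ge0.
  by rewrite mulrA mulrAC mulfK.
move=> Y [bY YE]; suff -> : adjoint T = Y by [].
apply: adjoint_unique => //.
apply: (dense_adjoint (@delta_densely_spanning _ _ beta)) => // a b.
rewrite hform_delta delta_hform Td YE deltaE.
rewrite eq_sym; case: eqP => [<-|_]; last by rewrite mulr0 conjC0 !mul0r.
rewrite mulr1 conj_real -!rmorphM /=; congr (_%:C%C).
by rewrite mulfVK// expf_neq0.
Qed.

Lemma Qop_diagonal (T : 'I_d -> H -> H) x X y :
  bounded_tuple T -> (forall i, is_weighted_shift i x (T i)) ->
  (forall f a, coefs (X f) a = (y a)%:C%C * coefs f a) ->
  forall f a, coefs (Qop T X f) a =
   (x a ^+ 2 * \sum_i w2 (mshift i a) / w2 a * y (mshift i a))%:C%C * coefs f a.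
Proof.
move=> bT Tx Xy f a; rewrite /Qop coefs_sum mulr_sumr rmorph_sum mulr_suml.
apply: eq_bigr => i _; rewrite (weighted_shift_adjoint (bT i) (Tx i)) Xy Tx.
rewrite coord_mul_shift !mulrA -!rmorphM /=; congr (_%:C%C * _); ring.
Qed.

End weighted_shifts.

(** * Radial weights, the Cauchy dual and the normal extension *)

Section balanced_weights.
Variables (R : realType) (d : nat) (beta : mindex d -> {posnum R}).
Variables (G : nat -> R) (m : mindex d -> R).
Local Notation H := (H2space beta).
Local Notation w2 a := ((beta a)%:num ^+ 2).
Hypotheses (w2E : forall a, w2 a = G (mdegree a) * m a)
  (G0 : forall k, 0 < G k) (m0 : forall a, 0 < m a)
  (m_sum : forall a, \sum_i m (mshift i a) = m a).

Lemma exists_mdegree k : (0 < d)%N -> exists a : mindex d, mdegree a = k.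
Proof.
move=> d0; exists [ffun j => if j == Ordinal d0 then k else 0%N].
rewrite /mdegree (eq_bigr (fun j => if j == Ordinal d0 then k else 0%N)); last first.
  by move=> j _; rewrite ffunE.
by rewrite -big_mkcond big_pred1_eq.
Qed.

(** Radial diagonal operators are preserved: the factor m of the weights
    disappears by [m_sum], and only the ratio of successive values of G
    remains. *)
Lemma Qop_radial (T : 'I_d -> H -> H) x X y :
  bounded_tuple T -> (forall i, is_weighted_shift i (fun a => x (mdegree a)) (T i)) ->
  (forall f a, coefs (X f) a = (y (mdegree a))%:C%C * coefs f a) ->
  forall f a, coefs (Qop T X f) a =
   (x (mdegree a) ^+ 2 * (G (mdegree a).+1 / G (mdegree a)) * y (mdegree a).+1)%:C%C
     * coefs f a.
Proof.
move=> bT Tx Xy f a; rewrite (Qop_diagonal bT Tx Xy); congr (_%:C%C * _).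
rewrite -mulrA; congr (_ * _); rewrite (eq_bigr (fun i =>
    (G (mdegree a).+1 / (G (mdegree a) * m a) * y (mdegree a).+1) * m (mshift i a))).
  rewrite -mulr_sumr m_sum; field.
  by rewrite !gt_eqF.
by move=> i _; rewrite !w2E mdegree_shift; ring.
Qed.

Lemma multiplication_tuple_Qop (T : 'I_d -> H -> H) :
  bounded_tuple T -> multiplication_tuple T ->
  forall f a, coefs (Qop T id f) a =
    (G (mdegree a).+1 / G (mdegree a))%:C%C * coefs f a.
Proof.
move=> bT mT f a; rewrite (Qop_radial (x := fun=> 1) (y := fun=> 1) bT).
- by rewrite expr1n mul1r mulr1.
- move=> i g; rewrite mT; congr coord_mul; apply/funext => b.
  by rewrite mul1r.
- by move=> g b; rewrite mul1r.
Qed.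

Section cauchy_dual.
Variables (T : 'I_d -> H -> H) (d_gt0 : (0 < d)%N).
Hypotheses (bT : bounded_tuple T) (mT : multiplication_tuple T)
  (T_left : jointly_left_invertible T).

(** The positive dimension provides a monomial of each degree to test the lower
    bound on. *)
Lemma left_invertible_ratio :
  exists2 c : R, 0 < c & forall k, c <= G k.+1 / G k.
Proof.
have [_ _ [c c0 cQ]] := T_left; exists c => // k.
have [a ak] := exists_mdegree k d_gt0.
have := cQ (delta beta a).
rewrite hformZl !hform_delta (multiplication_tuple_Qop bT mT) deltaE eqxx.
by rewrite mul1r mulr1 -!rmorphM lecR ak ler_pM2r// exprn_gt0.
Qed.

Lemma op_inv_QopE f a : coefs (op_inv (Qop T id) f) a =
  (G (mdegree a) / G (mdegree a).+1)%:C%C * coefs f a.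
Proof.
have [c c0 cG] := left_invertible_ratio.
have [] := @weighted_composition R _ beta id
    (fun a => G (mdegree a) / G (mdegree a).+1) c^-1 (fun _ _ => id).
- by rewrite invr_ge0 ltW.
- move=> b; rewrite ler_pM2r// ger0_norm; last by rewrite divr_ge0 ?ltW.
  by rewrite -[X in X <= _]invf_div lef_pV2 ?posrE// divr_gt0.
move=> Y [bY YE]; suff -> : op_inv (Qop T id) = Y by rewrite YE.
have GG b : (G (mdegree b) / G (mdegree b).+1)%:C%C *
    (G (mdegree b).+1 / G (mdegree b))%:C%C = 1 :> R[i].
  rewrite -rmorphM /= -[RHS]/(1%:C%C); congr (_%:C%C); field.
  by rewrite !gt_eqF.
apply: op_inv_unique => // g; apply: eq_coefs => b.
  by rewrite YE (multiplication_tuple_Qop bT mT) mulrA GG mul1r.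
by rewrite (multiplication_tuple_Qop bT mT) YE mulrA [X in X * _]mulrC GG mul1r.
Qed.

Lemma cauchy_dual_shift i : is_weighted_shift i
  (fun a => G (mdegree a) / G (mdegree a).+1) (spherical_cauchy_dual T i).
Proof.
move=> f; rewrite /spherical_cauchy_dual /= mT; congr coord_mul.
by apply/funext => a; rewrite op_inv_QopE.
Qed.

(** The product of the factors G_j / G_(j + 1) for j from k to k + n - 1
    telescopes. *)
Lemma cauchy_dual_iter n f a : bounded_tuple (spherical_cauchy_dual T) ->
  coefs (iter n (Qop (spherical_cauchy_dual T)) id f) a =
  (G (mdegree a) / G (mdegree a + n)%N)%:C%C * coefs f a.
Proof.
move=> bS; elim: n f a => [|n IH] f a.
  by rewrite addn0 divff ?gt_eqF// mul1r.
rewrite iterS (Qop_radial (x := fun k => G k / G k.+1)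
  (y := fun k => G k / G (k + n)%N) bS cauchy_dual_shift IH).
congr (_%:C%C * _); rewrite addSnnS; field.
by rewrite !gt_eqF.
Qed.

(** Evaluate the defining inequality at a monomial of degree k and divide by
    G_k. *)
Lemma hyperexpansion_alternating :
  joint_complete_hyperexpansion (spherical_cauchy_dual T) ->
  completely_alternating (fun k => (G k)^-1).
Proof.
move=> [bS hS] n k n0; have [a ak] := exists_mdegree k d_gt0.
have := hS n n0 (delta beta a).
rewrite hform0l !hform_delta coefs_sum.
rewrite (eq_bigr (fun j : 'I_n.+1 =>
    (G k * ((-1) ^+ j * 'C(n, j)%:R * (G (k + j)%N)^-1))%:C%C)); last first.
  move=> j _; rewrite coefsZ cauchy_dual_iter// deltaE eqxx mulr1 ak.
  rewrite !rmorphM rmorphXn rmorphN1 rmorph_nat /=; ring.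
rewrite iter_nablaE -(rmorph_sum (real_complex R)) -mulr_sumr -rmorphM lecR.
by rewrite pmulr_lle0 ?exprn_gt0// pmulr_rle0.
Qed.

End cauchy_dual.
End balanced_weights.

Section gram_operators.
Variables (R : realType) (H : hilbertSpace R) (S : Type) (phi : S -> H)
  (kappa : S -> S -> R).
Hypotheses (gk : gram_matrix phi kappa) (dphi : densely_spanning phi).

Lemma gram_extension (K : hilbertSpace R) (psi : S -> K) kappa' :
  gram_matrix psi kappa' -> psd (fun s t => kappa s t - kappa' s t) ->
  exists X : H -> K, bounded_linear X /\ forall s, X (phi s) = psi s.
Proof.
move=> gk' pk; apply: (bounded_extension (M := 1) dphi) => l.
by rewrite mul1r; exact: (gram_hnorm_le _ gk gk' pk).
Qed.

End gram_operators.

Lemma psd_comp (R : realType) (S T : Type) (s : T -> S) (kappa : S -> S -> R) :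
  psd kappa -> psd (fun t u => kappa (s t) (s u)).
Proof.
move=> pk l; have := pk [seq (p.1, s p.2) | p <- l].
by rewrite /quad big_map; under eq_bigr do rewrite big_map.
Qed.

Lemma psd_diagonal (R : realType) (S : eqType) (h : S -> R) :
  (forall s, 0 <= h s) -> psd (fun s t => (s == t)%:R * h s).
Proof.
move=> h0.
apply: eq_psd (psd_rescale (fun s => Num.sqrt (h s)) (@psd_same_class R S S id)).
move=> s t; case: eqP => [<-|_]; last by rewrite mulr0 mul0r.
by rewrite mulr1 mul1r -expr2 sqr_sqrtr.
Qed.

Section subnormality.
Variables (R : realType) (d : nat) (beta : mindex d -> {posnum R}).
Variables (G : nat -> R) (m : mindex d -> R).
Local Notation H := (H2space beta).
Local Notation S := (mindex d * mindex d)%type.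
Local Notation w2 a := ((beta a)%:num ^+ 2).
Hypotheses (w2E : forall a, w2 a = G (mdegree a) * m a)
  (G0 : forall k, 0 < G k) (m0 : forall a, 0 < m a)
  (m_sum : forall a, \sum_i m (mshift i a) = m a)
  (m_psd : psd (mixed_kernel m)) (G_cm : completely_monotone G).

Let w a : R := w2 a.

Let wE a : w a = m a * G (mdegree a). Proof. by rewrite /w w2E mulrC. Qed.

Lemma weight_kernel_psd : psd (mixed_kernel w).
Proof.
rewrite (_ : w = fun a => m a * G (mdegree a)); last exact/funext.
exact: psd_mixed_kernel_monotone.
Qed.

Lemma G_nonincreasing k : G k.+1 <= G k.
Proof. by have := G_cm 1 k; rewrite /= /nabla subr_ge0. Qed.

Lemma weight_shift_le i a : w (mshift i a) <= w a.
Proof.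
rewrite !wE mdegree_shift; apply: ler_pM; rewrite ?(ltW (m0 _)) ?(ltW (G0 _))//.
  by rewrite -(m_sum a) (bigD1 i)//= lerDl sumr_ge0// => j _; rewrite ltW.
exact: G_nonincreasing.
Qed.

(** On indices, multiplication of z^a conj(z)^b by z_i, and below by
    conj(z_i). *)
Definition mul_coord i (s : S) : S := (mshift i s.1, s.2).

Definition mul_conj_coord i (s : S) : S := (s.1, mshift i s.2).

Lemma mixed_kernel_mul_coord i s t : mixed_kernel w (mul_coord i s) (mul_coord i t) =
  mixed_kernel (fun a => w (mshift i a)) s t.
Proof.
rewrite /mixed_kernel !balanceP /= !madd_shiftl.
by rewrite (inj_eq (@mshift_inj d i)).
Qed.

Lemma mixed_kernel_mul_conj i s t :
  mixed_kernel w (mul_conj_coord i s) (mul_conj_coord i t) =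
  mixed_kernel (fun a => w (mshift i a)) s t.
Proof.
rewrite /mixed_kernel !balanceP /= !madd_shiftr.
by rewrite (inj_eq (@mshift_inj d i)).
Qed.

Lemma mixed_kernel_adjoint i s t :
  mixed_kernel w (mul_coord i s) t = mixed_kernel w s (mul_conj_coord i t).
Proof. by rewrite /mixed_kernel !balanceP /= madd_shiftl !madd_shiftr. Qed.

(** Since w a = G_k m a and m a is the sum over j of m (mshift j a), the sum over
    all j of the shifted weights is G_(k + 1) m a. So the kernel minus its i-th
    shift is the kernel of m times nabla G, plus the other shifts, and all of
    these are positive semidefinite. *)
Lemma weight_kernel_contraction i :
  psd (fun s t => mixed_kernel w s t - mixed_kernel (fun a => w (mshift i a)) s t).
Proof.
have pj j : psd (mixed_kernel (fun a => w (mshift j a))).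
  apply: eq_psd (psd_comp (mul_coord j) weight_kernel_psd) => s t.
  exact: mixed_kernel_mul_coord.
have pn : psd (mixed_kernel (fun a => m a * nabla G (mdegree a))).
  apply: psd_mixed_kernel_monotone => // n k.
  by rewrite -iterSr; exact: G_cm.
have ps := @psd_sum R S _ (index_enum 'I_d) (fun j => j != i) _ (fun j _ => pj j).
apply: eq_psd (psdD pn ps) => s t; rewrite /mixed_kernel /=.
rewrite -mulr_sumr -!mulrBr -mulrDr; congr (_ * _); set a := madd _ _.
have : \sum_j w (mshift j a) = m a * G (mdegree a).+1.
  under eq_bigr do rewrite wE mdegree_shift.
  by rewrite -mulr_suml m_sum.
rewrite (bigD1 i)//= => h.
have -> : \sum_(j < d | j != i) w (mshift j a) = m a * G (mdegree a).+1 - w (mshift i a).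
  by rewrite -h [RHS]addrC addKr.
by rewrite (wE a) /nabla; ring.
Qed.

Lemma delta_gram : gram_matrix (@delta R _ beta) (fun a b => (a == b)%:R * w a).
Proof.
move=> a b; rewrite hform_delta deltaE eq_sym.
by case: eqP => [->|_]; rewrite ?mul1r ?mul0r.
Qed.

(** Defined on monomials and extended by density, which spares estimating the
    norm of z_i f; that the extension acts on coefficients as [coord_mul] is again
    checked on monomials. *)
Lemma exists_multiplication_tuple : exists T : 'I_d -> H -> H,
  bounded_tuple T /\ multiplication_tuple T.
Proof.
have ex i : exists X : H -> H, bounded_linear X /\
    forall a, X (delta beta a) = delta beta (mshift i a).
  apply: (gram_extension delta_gram (@delta_densely_spanning _ _ beta)
     (kappa' := fun a b => (a == b)%:R * w (mshift i a))).
    by move=> a b; rewrite delta_gram (inj_eq (@mshift_inj d i)).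
  apply: eq_psd (psd_diagonal (h := fun a => w a - w (mshift i a)) _) => [a b|a].
    by rewrite mulrBr.
  by rewrite subr_ge0 weight_shift_le.
have [T hT] := choice ex; exists T; split=> [i|i f]; first by have [] := hT i.
have [bT Td] := hT i; have [Tl _ [M M0 TM]] := bounded_linearP bT.
apply/funext => b; apply/eqP; rewrite -subr_eq0; apply/eqP.
pose c a : R := ((beta a)%:num)^-1.
have le_c (g : H) a : normc (coefs g a) <= c a * hnorm g.
  by rewrite mulrC ler_pdivlMr// coef_le_hnorm.
apply: (dense_functional_eq0 (@delta_densely_spanning _ _ beta)
  (f := fun f : H => coefs (T i f) b - coord_mul i (coefs f) b)
  (M := c b * M + c (munshift i b))).
- move=> a g h; rewrite Tl coefsD coefsZ /coord_mul; case: ifP => _.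
    by rewrite coefsD coefsZ; ring.
  by rewrite !subr0.
- move=> g; apply: (le_trans (le_normcD _ _)); rewrite normcN mulrDl.
  apply: lerD.
    by apply: (le_trans (le_c _ _)); rewrite -mulrA ler_wpM2l// invr_ge0.
  rewrite /coord_mul; case: ifP => _; first exact: le_c.
  by rewrite normc0 mulr_ge0 ?hnorm_ge0// invr_ge0.
- by move=> a; rewrite Td coord_mul_delta1 subrr.
Qed.

Section with_tuple.
Variable T : 'I_d -> H -> H.
Hypotheses (bT : bounded_tuple T) (mT : multiplication_tuple T).

Lemma multiplication_delta i a : T i (delta beta a) = delta beta (mshift i a).
Proof.
by apply: eq_coefs => b; rewrite mT coord_mul_delta1.
Qed.

Lemma multiplication_commuting : commuting T.
Proof.
move=> i j x; apply: (dense_eq (X := T i \o T j) (Y := T j \o T i)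
  (@delta_densely_spanning _ _ beta)) => [||a].
- exact: (bounded_linear_comp (bT i) (bT j)).
- exact: (bounded_linear_comp (bT j) (bT i)).
by rewrite /= !multiplication_delta mshiftC.
Qed.

Lemma multiplication_contraction : spherical_contraction T.
Proof.
split=> //; first exact: multiplication_commuting.
move=> f; rewrite -subr_ge0 -hformBl.
apply: (diagonal_form_ge0 (y := fun a => 1 - G (mdegree a).+1 / G (mdegree a))).
  by move=> a; rewrite subr_ge0 ler_pdivrMr// mul1r G_nonincreasing.
move=> a; rewrite coefsB (multiplication_tuple_Qop w2E G0 m0 m_sum bT mT).
by rewrite rmorphB mulrBl mul1r.
Qed.

Lemma multiplication_subnormal : subnormal T.
Proof.
split=> //; first exact: multiplication_commuting.
have [K [phi [gphi dphi]]] :=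
  kernel_realization (mixed_kernel_sym w) weight_kernel_psd.
have exN i : exists X : K -> K, bounded_linear X /\
    forall s, X (phi s) = phi (mul_coord i s).
  apply: (gram_extension gphi dphi _ (weight_kernel_contraction i)) => s t.
  by rewrite gphi mixed_kernel_mul_coord.
have exA i : exists X : K -> K, bounded_linear X /\
    forall s, X (phi s) = phi (mul_conj_coord i s).
  apply: (gram_extension gphi dphi _ (weight_kernel_contraction i)) => s t.
  by rewrite gphi mixed_kernel_mul_conj.
have [N hN] := choice exN; have [A hA] := choice exA.
have bN i : bounded_linear (N i) := (hN i).1.
have bA i : bounded_linear (A i) := (hA i).1.
have Nphi i s : N i (phi s) = phi (mul_coord i s) := (hN i).2 s.
have Aphi i s : A i (phi s) = phi (mul_conj_coord i s) := (hA i).2 s.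
(* z^a as the mixed monomial with trivial antiholomorphic part *)
have gV : gram_matrix (fun a => phi (a, [ffun=> 0%N])) (fun a b => (a == b)%:R * w a).
  move=> a b; rewrite gphi /mixed_kernel balanceP /=.
  have madd0 e : madd e [ffun=> 0%N] = e.
    by apply/ffunP => j; rewrite !ffunE addn0.
  by rewrite !madd0.
have [V [bV Vd]] : exists V : H -> K, bounded_linear V /\
    forall a, V (delta beta a) = phi (a, [ffun=> 0%N]).
  apply: (gram_extension delta_gram (@delta_densely_spanning _ _ beta) gV).
  by apply: eq_psd (@psd0 R _) => a b; rewrite subrr.
have adjN i : adjoint (N i) = A i.
  apply: (adjoint_unique (bA i)); apply: (dense_adjoint dphi (bN i) (bA i)) => s t.
  by rewrite Nphi Aphi !gphi mixed_kernel_adjoint.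
exists K, V, N; split.
- by have [] := bV.
- apply: (dense_isometry (@delta_densely_spanning _ _ beta) bV) => a b.
  by rewrite !Vd gV delta_gram.
- move=> i; split; first exact: bN.
  rewrite adjN; apply/funext => x.
  apply: (dense_eq dphi (X := A i \o N i) (Y := N i \o A i)) => [||s].
  + exact: (bounded_linear_comp (bA i) (bN i)).
  + exact: (bounded_linear_comp (bN i) (bA i)).
  by rewrite /= Nphi Aphi Aphi Nphi.
- move=> i j x; apply: (dense_eq dphi (X := N i \o N j) (Y := N j \o N i)) => [||s].
  + exact: (bounded_linear_comp (bN i) (bN j)).
  + exact: (bounded_linear_comp (bN j) (bN i)).
  by rewrite /= !Nphi /mul_coord /= mshiftC.
- move=> i x; apply: (dense_eq (@delta_densely_spanning _ _ beta)
    (X := N i \o V) (Y := V \o T i)) => [||a].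
  + exact: (bounded_linear_comp (bN i) bV).
  + exact: (bounded_linear_comp bV (bT i)).
  by rewrite /= multiplication_delta !Vd Nphi.
Qed.

End with_tuple.
End subnormality.

(** * Members of the class *)

Section class_members.
Variables (R : realType) (d : nat) (nu : {finite_measure set (borel_Cd R d) -> \bar R}).
Hypotheses (d_gt0 : (0 < d)%N) (nu_reinhardt : reinhardt nu).

(** Depends on nu alone, so two members of the class share it. *)
Definition moment (a : mindex d) : R :=
  fine (\int[nu]_z (sqmon a (z : borel_Cd R d))%:E)%E.

Lemma sqr_kernel_weight (K : diag_kernel R d) a :
  (kernel_weight K a)%:num ^+ 2 = ((kcoef K a)%:num)^-1.
Proof. by rewrite /= sqr_sqrtr// invr_ge0. Qed.

Lemma slice_moments (beta : mindex d -> {posnum R}) (gamma : nat -> {posnum R}) :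
  slice_representation beta nu gamma ->
  [/\ forall a, (\int[nu]_z (sqmon a (z : borel_Cd R d))%:E = (moment a)%:E)%E,
      forall a, 0 < moment a &
      forall a, (beta a)%:num ^+ 2 = (gamma (mdegree a))%:num ^+ 2 * moment a].
Proof.
move=> srep; have intE a := slice_moment a srep.
have momentE a : moment a = ((beta a)%:num / (gamma (mdegree a))%:num) ^+ 2.
  by rewrite /moment intE.
split=> a; rewrite ?momentE ?intE//.
by rewrite -exprMn mulrCA mulfV ?mulr1.
Qed.

Lemma class_K_alternating (K : diag_kernel R d) : class_K nu K ->
  [/\ forall a, (\int[nu]_z (sqmon a (z : borel_Cd R d))%:E = (moment a)%:E)%E,
      forall a, 0 < moment a &
      exists c : nat -> R, [/\ forall k, 0 < c k, completely_alternating c &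
        forall a, (kcoef K a)%:num = c (mdegree a) / moment a]].
Proof.
move=> [_ [gamma srep] [T [mT bT Tleft Thyp]]].
have [intE m0 bE] := slice_moments srep; split=> //.
exists (fun k => ((gamma k)%:num ^+ 2)^-1); split=> [k||a].
- by rewrite invr_gt0 exprn_gt0.
- have g0 k : 0 < (gamma k)%:num ^+ 2 by rewrite exprn_gt0.
  have m_sum := moment_sum nu_reinhardt.1 intE.
  apply: (@hyperexpansion_alternating _ _ _ (fun k => (gamma k)%:num ^+ 2) _
    bE g0 m0 m_sum T) => //.
- by apply: invr_inj; rewrite -sqr_kernel_weight bE invf_div invrK mulrC.
Qed.

End class_members.

Theorem theorem3p7 (R : realType) (d : nat) (hd : (0 < d)%N)
  (nu : {finite_measure set (borel_Cd R d) -> \bar R}) (hnu : reinhardt nu)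
  (K1 K2 : diag_kernel R d) (hK1 : class_K nu K1) (hK2 : class_K nu K2) :
  exists Mz : 'I_d -> rkhs (kernel_add K1 K2) -> rkhs (kernel_add K1 K2),
    multiplication_tuple Mz /\ subnormal Mz /\ spherical_contraction Mz.
Proof.
have [intE m0 [c1 [c10 c1_alt c1E]]] := class_K_alternating hd hnu hK1.
have [_ _ [c2 [c20 c2_alt c2E]]] := class_K_alternating hd hnu hK2.
pose c k := c1 k + c2 k; pose G k := (c k)^-1.
have c0 k : 0 < c k by rewrite addr_gt0.
have G0 k : 0 < G k by rewrite invr_gt0.
have G_cm : completely_monotone G.
  apply: completely_monotoneV => // n k n0.
  by rewrite iter_nablaD -[0]addr0 lerD ?c1_alt ?c2_alt.
have m_sum a : \sum_i moment nu (mshift i a) = moment nu a.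
  exact: (moment_sum hnu.1 intE).
have m_psd := moment_psd intE.
have w2E a : (kernel_weight (kernel_add K1 K2) a)%:num ^+ 2 =
    G (mdegree a) * moment nu a.
  by rewrite sqr_kernel_weight /= c1E c2E -mulrDl invf_div mulrC.
have [Mz [bM mM]] := exists_multiplication_tuple w2E G0 m0 m_sum G_cm.
exists Mz; split=> //; split.
  exact: (multiplication_subnormal w2E m_sum m_psd G_cm bM mM).
exact: (multiplication_contraction w2E G0 m0 m_sum G_cm bM mM).
Qed.
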